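(* Let $(M,\boldsymbol{g})$ be an $n$-dimensional Einstein space, i.e. $R_{ab}=\Lambda g_{ab}$ with $\Lambda$ constant, with metric of arbitrary signature. Let $2<p<n$ and let $\boldsymbol{Y}$ be a conformal Killing-Yano tensor of order $p$ on $M$ that is not a Killing-Yano tensor, so that $$h_{b_2\cdots b_p}=\frac{p}{2(n+1-p)}\,\nabla^aY_{ab_2\cdots b_p}$$ is not identically zero. Then $\boldsymbol h$ is a Killing-Yano tensor of order $p-1$ if and only if $$C^{a\hat f}{}_{\hat e(c}\,Y_{d)a\hat F}=0 .$$
   Context: $\nabla$ is the Levi-Civita connection, $R_{ab}$ the Ricci tensor and $C_{abcd}$ the Weyl tensor of $\boldsymbol g$. Square (round) brackets denote normalized (weight one) antisymmetrization (symmetrization) over the enclosed free indices. A totally skew-symmetric tensor $\boldsymbol Y$ of rank $p$ is a conformal Killing-Yano tensor of order $p$ if there is a skew-symmetric tensor $\boldsymbol h$ of rank $p-1$ such that $$\nabla_a Y_{b_1b_2\cdots b_p}+\nabla_{b_1}Y_{ab_2\cdots b_p}=2g_{a[b_1}h_{b_2\cdots b_p]}+2g_{b_1[a}h_{b_2\cdots b_p]};$$ then necessarily $h_{b_2\cdots b_p}=\frac{p}{2(n+1-p)}\nabla^aY_{ab_2\cdots b_p}$. It is a Killing-Yano tensor if this holds with $\boldsymbol h=0$. Notation: for free indices $c,d,e_3,\dots,e_p$, $$C^{a\hat f}{}_{\hat e c}\,Y_{da\hat F}=\sum_{i=3}^{p}C^{af}{}_{e_i c}\,Y_{da e_3\cdots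 e_{i-1}fe_{i+1}\cdots e_p}$$ (the index $e_i$ of $Y$ is replaced by the contracted index $f$), and $C^{a\hat f}{}_{\hat e(c}\,Y_{d)a\hat F}$ is its symmetrization in $c,d$. *)

(* Defs.v *)
From mathcomp Require Import all_boot all_order all_algebra all_fingroup.
From mathcomp Require Import all_classical all_reals all_analysis.
Set Implicit Arguments.
Unset Strict Implicit.
Unset Printing Implicit Defensive.
Import Order.TTheory GRing.Theory Num.Theory.
Import numFieldNormedType.Exports.
Local Open Scope classical_set_scope.
Local Open Scope ring_scope.

Section Calculus.
Context {R : realType} {n : nat}.
Implicit Types (f : 'rV[R]_n -> R) (U : set 'rV[R]_n).

Definition partial (a : 'I_n) f : 'rV[R]_n -> R :=
  fun x => 'D_(delta_mx 0 a) f x.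

Fixpoint Ck (k : nat) U f : Prop :=
  {in U, continuous f} /\
  if k is k'.+1 then
    forall a, (forall x, U x -> derivable f x (delta_mx 0 a)) /\
              Ck k' U (partial a f)
  else True.

Definition smooth_on U f : Prop := forall k, Ck k U f.

End Calculus.

(* Atlases are not required to be maximal: the notions below do not depend on
   the choice of an atlas in a given smooth structure.  The values of the
   coordinate maps off [cdom], and of their inverses off [cimg], are junk. *)
Record manifold (R : realType) (n : nat) := Manifold {
  carrier :> topologicalType;
  carrier_hausdorff : hausdorff_space carrier;
  carrier_second_countable : @second_countable carrier;
  chart : Type;
  cdom : chart -> set carrier;
  cimg : chart -> set 'rV[R]_n;
  coord : chart -> carrier -> 'rV[R]_n;
  icoord : chart -> 'rV[R]_n -> carrier;
  cdom_open : forall i, open (cdom i);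
  cimg_open : forall i, open (cimg i);
  coord_img : forall i m, cdom i m -> cimg i (coord i m);
  icoord_dom : forall i x, cimg i x -> cdom i (icoord i x);
  coordK : forall i m, cdom i m -> icoord i (coord i m) = m;
  icoordK : forall i x, cimg i x -> coord i (icoord i x) = x;
  coord_cont : forall i, {in cdom i, continuous (coord i)};
  icoord_cont : forall i, {in cimg i, continuous (icoord i)};
  cdom_cover : forall m, exists i, cdom i m;
  transition_smooth : forall i j (c : 'I_n),
    smooth_on (cimg i `&` icoord i @^-1` cdom j)
              (fun x => coord j (icoord i x) 0 c)
}.

Section MultiIndices.
Context {n : nat}.

(* (e_1, ..., e_{i-1}, f, e_{i+1}, ..., e_k) *)
Definition tsubst k (E : k.-tuple 'I_n) (i : 'I_k) (f : 'I_n) :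
    k.-tuple 'I_n :=
  [tuple if j == i then f else tnth E j | j < k].

Definition tperm_idx k (E : k.-tuple 'I_n) (s : 'S_k) : k.-tuple 'I_n :=
  [tuple tnth E (s j) | j < k].

End MultiIndices.

(* Tensor calculus in one coordinate patch.  All indices are lower indices;
   raised indices are written out with the inverse metric. *)
Section Patch.
Context {R : realType} {n : nat}.

Definition comps (k : nat) := k.-tuple 'I_n -> 'rV[R]_n -> R.

Variable g : comps 2.

Definition gmx (x : 'rV[R]_n) : 'M[R]_n := \matrix_(a, b) g [tuple a; b] x.

Definition ginv (a b : 'I_n) (x : 'rV[R]_n) : R := invmx (gmx x) a b.

(* Gamma^c_{ab} of the Levi-Civita connection *)
Definition christoffel (c a b : 'I_n) (x : 'rV[R]_n) : R :=
  2^-1 * \sum_d ginv c d x *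
    (partial a (g [tuple b; d]) x + partial b (g [tuple a; d]) x
     - partial d (g [tuple a; b]) x).

(* nabla_a T_{b_1 ... b_k} *)
Definition nabla k (T : comps k) (a : 'I_n) (B : k.-tuple 'I_n)
    (x : 'rV[R]_n) : R :=
  partial a (T B) x
  - \sum_(i < k) \sum_c christoffel c a (tnth B i) x * T (tsubst B i c) x.

(* R_{ab}{}^d{}_c, i.e. the d-component of
   (nabla_a nabla_b - nabla_b nabla_a) d_c *)
Definition riemann_up (a b c d : 'I_n) (x : 'rV[R]_n) : R :=
  partial a (christoffel d b c) x - partial b (christoffel d a c) x
  + \sum_e (christoffel d a e x * christoffel e b c x
            - christoffel d b e x * christoffel e a c x).

(* Sign convention: R_{abcd} = g_{ac} g_{bd} - g_{ad} g_{bc} on the unit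
   sphere. *)
Definition riemann (a b c d : 'I_n) (x : 'rV[R]_n) : R :=
  \sum_e g [tuple c; e] x * riemann_up a b d e x.

Definition ricci (a b : 'I_n) (x : 'rV[R]_n) : R :=
  \sum_c \sum_d ginv c d x * riemann c a d b x.

Definition scalar_curvature (x : 'rV[R]_n) : R :=
  \sum_a \sum_b ginv a b x * ricci a b x.

Definition weyl (a b c d : 'I_n) (x : 'rV[R]_n) : R :=
  let G u v := g [tuple u; v] x in
  let Ric u v := ricci u v x in
  riemann a b c d x
  - (n%:R - 2)^-1 *
      (G a c * Ric d b - G a d * Ric c b - G b c * Ric d a + G b d * Ric c a)
  + scalar_curvature x / ((n%:R - 1) * (n%:R - 2)) *
      (G a c * G d b - G a d * G c b).

(* T_{[b_1 ... b_k]} *)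
Definition antisym k (T : comps k) : comps k := fun B x =>
  (k`!)%:R^-1 * \sum_(s : 'S_k) (-1) ^+ s * T (tperm_idx B s) x.

(* g_{a [b_1} h_{b_2 ... b_{k+1}]} *)
Definition metric_wedge k (h : comps k) (a : 'I_n) : comps k.+1 :=
  antisym (fun B x => g [tuple a; thead B] x * h [tuple of behead B] x).

(* nabla^a Y_{a b_2 ... b_p} *)
Definition divergence k (Y : comps k.+1) : comps k := fun B x =>
  \sum_a \sum_b ginv a b x * nabla Y b [tuple of a :: B] x.

(* C^{a \hat f}{}_{\hat e c} Y_{d a \hat F}, with E = (e_3, ..., e_p) and
   p = k.+2 *)
Definition weyl_contr k (Y : comps k.+2) (c d : 'I_n) (E : k.-tuple 'I_n)
    (x : 'rV[R]_n) : R :=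
  \sum_(i < k) \sum_a \sum_f
    (\sum_a' \sum_f' ginv a a' x * ginv f f' x * weyl a' f' (tnth E i) c x)
    * Y [tuple of d :: a :: tsubst E i f] x.

End Patch.
Arguments comps : clear implicits.

Section Tensors.
Context {R : realType} {n : nat}.
Variable M : manifold R n.

(* A covariant tensor field of rank k is given by its components in the charts,
   as functions of the coordinates; only the values on [cimg i] matter. *)
Definition fields (k : nat) := chart M -> comps R n k.

Definition transition (i j : chart M) (x : 'rV[R]_n) : 'rV[R]_n :=
  coord j (icoord i x).

(* d y^c / d x^b, for x the coordinates of chart i and y those of chart j *)
Definition jac (i j : chart M) (c b : 'I_n) : 'rV[R]_n -> R :=
  partial b (fun x => transition i j x 0 c).

Definition is_tensor k (T : fields k) : Prop :=
  (forall i B, smooth_on (cimg i) (T i B)) /\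
  (forall i j x, cimg i x -> cdom j (icoord i x) ->
     forall B : k.-tuple 'I_n,
       T i B x = \sum_(C : k.-tuple 'I_n)
         (\prod_(l < k) jac i j (tnth C l) (tnth B l) x)
         * T j C (transition i j x)).

Definition is_skew k (T : fields k) : Prop :=
  forall i x, cimg i x -> forall (B : k.-tuple 'I_n) (s : 'S_k),
    T i (tperm_idx B s) x = (-1) ^+ s * T i B x.

(* Pseudo-Riemannian metrics: no condition on the signature. *)
Definition is_metric (g : fields 2) : Prop :=
  [/\ is_tensor g,
      forall i x, cimg i x -> forall a b,
        g i [tuple a; b] x = g i [tuple b; a] x
    & forall i x, cimg i x -> gmx (g i) x \in unitmx].

Definition is_einstein (g : fields 2) (Lambda : R) : Prop :=
  forall i x, cimg i x -> forall a b,
    ricci (g i) a b x = Lambda * g i [tuple a; b] x.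

Variable g : fields 2.

(* The equation for Y of rank p = k.+1 and h of rank p - 1 = k. *)
Definition CKY_eq k (Y : fields k.+1) (h : fields k) : Prop :=
  forall i x, cimg i x -> forall (a b : 'I_n) (B : k.-tuple 'I_n),
    nabla (g i) (Y i) a [tuple of b :: B] x
    + nabla (g i) (Y i) b [tuple of a :: B] x
    = 2 * metric_wedge (g i) (h i) a [tuple of b :: B] x
      + 2 * metric_wedge (g i) (h i) b [tuple of a :: B] x.

Definition is_CKY k (Y : fields k.+1) : Prop :=
  [/\ is_tensor Y, is_skew Y
    & exists h : fields k, [/\ is_tensor h, is_skew h & CKY_eq Y h]].

Definition is_KY k (Y : fields k.+1) : Prop :=
  [/\ is_tensor Y, is_skew Y & CKY_eq Y (fun _ _ _ => 0)].

(* h_{b_2 ... b_p} = p / (2 (n + 1 - p)) nabla^a Y_{a b_2 ... b_p}, p = k.+1 *)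
Definition CKY_h k (Y : fields k.+1) : fields k := fun i B x =>
  (k.+1)%:R / (2 * (n%:R + 1 - (k.+1)%:R)) * divergence (g i) (Y i) B x.

(* C^{a \hat f}{}_{\hat e (c} Y_{d) a \hat F} = 0 *)
Definition weyl_condition k (Y : fields k.+2) : Prop :=
  forall i x, cimg i x -> forall (c d : 'I_n) (E : k.-tuple 'I_n),
    2^-1 * (weyl_contr (g i) (Y i) c d E x + weyl_contr (g i) (Y i) d c E x)
    = 0.

End Tensors.

(* Main.v *)
(* The h of the conformal Killing-Yano equation is necessarily the multiple
   (p / (2 (n + 1 - p))) nabla^a Y_{aB} of the divergence of Y, as one sees by
   contracting the equation.  Hence nabla_c h_{dE} + nabla_d h_{cE} is a multiple
   of the symmetrization in c, d of g^{ab} nabla_c nabla_b Y_{adE}.  Commuting the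
   two derivatives gives a curvature term, and the remaining
   g^{ab} nabla_b nabla_(c Y_{|a|d)E} is evaluated with the derivative of the
   conformal Killing-Yano equation: since h is divergence free, it is again a
   multiple of nabla_(c h_{d)E}.  In the curvature term the Ricci parts cancel by
   the Einstein condition, and pair symmetry and the Bianchi identity leave the
   contraction of the Riemann tensor over one slot of E, in which it may be
   replaced by the Weyl tensor.  At every point this yields
     (2 (n - p) / p) (nabla_c h_{dE} + nabla_d h_{cE})
       = (W_{cdE} + W_{dcE}) / 2
   with W_{cdE} the Weyl contraction of the theorem, and n - p is not zero. *)
Require Import Defs.
From mathcomp Require Import all_boot all_order all_algebra all_fingroup.
From mathcomp Require Import all_classical all_reals all_analysis.
From mathcomp Require Import ring lra.
Set Implicit Arguments.
Unset Strict Implicit.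
Unset Printing Implicit Defensive.
Import Order.TTheory GRing.Theory Num.Theory.
Import numFieldNormedType.Exports.
Local Open Scope classical_set_scope.
Local Open Scope ring_scope.

(** * Second partial derivatives commute *)

Section Schwarz.
Context {R : realType} {V : normedModType R}.
Implicit Types (f : V -> R) (x u v : V).

Lemma is_derive_line f x v (t d : R) : is_derive (x + t *: v) v f d ->
  is_derive t 1 (fun s : R => f (x + s *: v)) d.
Proof.
have E : (fun h : R => h^-1 *: (((fun s : R => f (x + s *: v)) \o shift t) (h *: 1) -
     f (x + t *: v))) =
   (fun h : R => h^-1 *: ((f \o shift (x + t *: v)) (h *: v) - f (x + t *: v))).
  by apply/funext => h /=; rewrite [h *: 1]mulr1 scalerDl addrCA.
case=> df <-; apply: DeriveDef; first by rewrite /derivable E.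
by rewrite /derive E.
Qed.

Lemma MVT_line (phi dphi : R -> R) (h : R) : 0 < h ->
  (forall t, 0 <= t <= h -> is_derive t 1 phi (dphi t)) ->
  exists2 c, 0 <= c <= h & phi h - phi 0 = dphi c * h.
Proof.
move=> h0 dp.
have [||c] := @MVT_segment R phi dphi 0 h (ltW h0).
- by move=> t; rewrite in_itv /= => /andP[a b]; apply: dp; rewrite !ltW.
- apply: derivable_within_continuous => t; rewrite in_itv /= => ht.
  by have [] := dp t ht.
by rewrite in_itv /= subr0 => hc ->; exists c.
Qed.

(** The mean value theorem is used twice: along [u] for the increment of [f] in direction [h *: v],
    then along [v] for the resulting increment of [fu]. *)
Lemma mixed_difference f (fu fuv : V -> R) x u v (h : R) : 0 < h ->
  (forall s t, 0 <= s <= h -> 0 <= t <= h ->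
    is_derive (x + s *: u + t *: v) u f (fu (x + s *: u + t *: v)) /\
    is_derive (x + s *: u + t *: v) v fu (fuv (x + s *: u + t *: v))) ->
  exists2 st : R * R, (0 <= st.1 <= h) && (0 <= st.2 <= h) &
    (f (x + h *: u + h *: v) - f (x + h *: u)) - (f (x + h *: v) - f x) =
    fuv (x + st.1 *: u + st.2 *: v) * h * h.
Proof.
move=> h0 df; have hh : 0 <= h <= h by apply/andP; split=> //; exact: ltW.
have h00 : 0 <= (0 : R) <= h by rewrite lexx ltW.
have [|c hc] := @MVT_line (fun s : R => f (x + h *: v + s *: u) - f (x + s *: u))
  (fun s => fu (x + h *: v + s *: u) - fu (x + s *: u)) h h0.
  move=> t ht; apply: is_deriveB; apply: is_derive_line.
    by have [] := df t h ht hh; rewrite (addrAC x (t *: u)).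
  by have [] := df t 0 ht h00; rewrite scale0r addr0.
rewrite scale0r !addr0 (addrAC x (h *: v)) => E1.
have [|d hd] := @MVT_line (fun t : R => fu (x + c *: u + t *: v))
  (fun t => fuv (x + c *: u + t *: v)) h h0.
  move=> t ht; apply: is_derive_line.
  by have [] := df c t hc ht.
rewrite scale0r addr0 => E2; exists (c, d); first by rewrite hc hd.
by rewrite /= -E2 (addrAC x (c *: u)) -E1; ring.
Qed.

(** The second difference over a small parallelogram is symmetric in [u] and [v], so [fuv] at one
    point near [x] equals [fvu] at another. Continuity then excludes different values at [x]. *)
Lemma is_derive_comm (U : set V) f (fu fv fuv fvu : V -> R) x u v : open U -> U x ->
  (forall y, U y -> [/\ is_derive y u f (fu y), is_derive y v f (fv y),
     is_derive y v fu (fuv y) & is_derive y u fv (fvu y)]) ->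
  {for x, continuous fuv} -> {for x, continuous fvu} ->
  fuv x = fvu x.
Proof.
move=> oU Ux dU cvu cuv; apply/eqP/negPn/negP => ne.
have e0 : 0 < `|fuv x - fvu x| / 2 by rewrite divr_gt0// normr_gt0 subr_eq0.
have nA : \forall y \near x, `|fuv x - fuv y| < `|fuv x - fvu x| / 2.
  by move/cvgr_dist_lt: cvu; apply.
have nB : \forall y \near x, `|fvu x - fvu y| < `|fuv x - fvu x| / 2.
  by move/cvgr_dist_lt: cuv; apply.
have nU : \forall y \near x, U y by exact: open_nbhs_nbhs.
have nUAB := filterI nU (filterI nA nB).
have [r /= r0 br] := (nbhs_ballP _ _).1 (nUAB _ _).
(* The summand 1 keeps [m] positive when [u] and [v] vanish; [h * m] is half of [r], so the
   parallelogram stays in the ball. *)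
pose m := `|u| + `|v| + 1.
have m0 : 0 < m by rewrite ltr_wpDl// addr_ge0.
pose h := r / m / 2.
have h0 : 0 < h by rewrite !divr_gt0.
have inb s t : 0 <= s <= h -> 0 <= t <= h -> ball x r (x + s *: u + t *: v).
  move=> /andP[s0 sh] /andP[t0 th].
  rewrite -ball_normE /ball_ /= opprD addrA opprD addrA subrr add0r.
  rewrite -opprD normrN (le_lt_trans (ler_normD _ _))//.
  rewrite !normrZ !ger0_norm//.
  apply: (@le_lt_trans _ _ (h * m)).
    rewrite /m !mulrDr mulr1 ler_wpDr ?(ltW h0)//.
    by apply: lerD; rewrite ler_wpM2r.
  by rewrite /h mulrAC divfK ?gt_eqF// ltr_pdivrMr// mulr_natr mulr2n ltrDl.
have [|[s t] /= /andP[hs ht] E1] := @mixed_difference f fu fuv x u v h h0.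
  by move=> s t hs ht; have [/dU[]] := br _ (inb s t hs ht).
have [|[s' t'] /= /andP[hs' ht'] E2] := @mixed_difference f fv fvu x v u h h0.
  move=> a b ha hb; have := inb b a hb ha.
  by rewrite (addrAC x (b *: u)) => /br[/dU[]].
have E : fuv (x + s *: u + t *: v) = fvu (x + s' *: v + t' *: u).
  apply: (mulIf (lt0r_neq0 h0)); apply: (mulIf (lt0r_neq0 h0)); rewrite -E1 -E2.
  by rewrite (addrAC x (h *: v)); ring.
have [_ [H1 _]] := br _ (inb _ _ hs ht).
have := inb _ _ ht' hs'; rewrite (addrAC x (t' *: u)) => /br[_ [_ H2]].
rewrite /= -E in H2; rewrite /= in H1.
have := ltrD H1 H2; rewrite -splitr (distrC (fvu x)) => /(le_lt_trans (ler_distD _ _ _)).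
by rewrite ltxx.
Qed.

End Schwarz.

(** * Partial derivatives of functions of the coordinates *)

Section Partial.
Context {R : realType} {n : nat}.
Implicit Types (f h : 'rV[R]_n -> R) (x : 'rV[R]_n) (U : set 'rV[R]_n).
Implicit Types a b c : 'I_n.

Definition pderivable f x : Prop := forall a, derivable f x (delta_mx 0 a).

Lemma pderivable_cst (k : R) x : pderivable (fun=> k) x.
Proof. by move=> a; exact: derivable_cst. Qed.

Lemma pderivableD f h x : pderivable f x -> pderivable h x ->
  pderivable (fun y => f y + h y) x.
Proof. by move=> df dh a; exact: derivableD. Qed.

Lemma pderivableB f h x : pderivable f x -> pderivable h x ->
  pderivable (fun y => f y - h y) x.
Proof. by move=> df dh a; exact: derivableB. Qed.

Lemma pderivableM f h x : pderivable f x -> pderivable h x ->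
  pderivable (fun y => f y * h y) x.
Proof. by move=> df dh a; exact: derivableM. Qed.

Lemma pderivableV f x : f x != 0 -> pderivable f x ->
  pderivable (fun y => (f y)^-1) x.
Proof. by move=> f0 df a; exact: derivableV. Qed.

Lemma pderivable_sum I (r : seq I) (P : pred I) (F : I -> 'rV[R]_n -> R) x :
  (forall i, P i -> pderivable (F i) x) ->
  pderivable (fun y => \sum_(i <- r | P i) F i y) x.
Proof.
move=> dF; elim: r => [|i r IH].
  under eq_fun do rewrite big_nil; exact: pderivable_cst.
under eq_fun do rewrite big_cons.
case Pi: (P i); last by [].
exact: pderivableD (dF i Pi) IH.
Qed.

Lemma pderivable_prod I (r : seq I) (P : pred I) (F : I -> 'rV[R]_n -> R) x :
  (forall i, P i -> pderivable (F i) x) ->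
  pderivable (fun y => \prod_(i <- r | P i) F i y) x.
Proof.
move=> dF; elim: r => [|i r IH].
  under eq_fun do rewrite big_nil; exact: pderivable_cst.
under eq_fun do rewrite big_cons.
case Pi: (P i); last by [].
exact: pderivableM (dF i Pi) IH.
Qed.

Lemma partial_cst (k : R) a x : partial a (fun=> k) x = 0.
Proof. exact: derive_cst. Qed.

Lemma partialD f h a x : pderivable f x -> pderivable h x ->
  partial a (fun y => f y + h y) x = partial a f x + partial a h x.
Proof. by move=> df dh; exact: deriveD. Qed.

Lemma partialB f h a x : pderivable f x -> pderivable h x ->
  partial a (fun y => f y - h y) x = partial a f x - partial a h x.
Proof. by move=> df dh; exact: deriveB. Qed.

Lemma partialM f h a x : pderivable f x -> pderivable h x ->
  partial a (fun y => f y * h y) x = partial a f x * h x + f x * partial a h x.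
Proof.
move=> df dh; rewrite [LHS]deriveM; [|exact: df|exact: dh].
by rewrite addrC; congr (_ + _); exact: mulrC.
Qed.

Lemma partial_sum I (r : seq I) (P : pred I) (F : I -> 'rV[R]_n -> R) a x :
  (forall i, P i -> pderivable (F i) x) ->
  partial a (fun y => \sum_(i <- r | P i) F i y) x =
  \sum_(i <- r | P i) partial a (F i) x.
Proof.
move=> dF; elim: r => [|i r IH].
  rewrite big_nil -[RHS](partial_cst 0 a x); congr (partial a _ x).
  by apply/funext => y; rewrite big_nil.
rewrite big_cons -IH; case: ifP => Pi.
  rewrite -partialD; [|exact: dF|exact: pderivable_sum].
  by congr (partial a _ x); apply/funext => y; rewrite big_cons Pi.
by congr (partial a _ x); apply/funext => y; rewrite big_cons Pi.
Qed.

Lemma partial_eq_on U f h a x : open U -> U x -> (forall y, U y -> f y = h y) ->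
  partial a f x = partial a h x.
Proof.
move=> oU Ux fh; apply: near_eq_derive.
by apply: filterS (open_nbhs_nbhs (conj oU Ux)) => y; exact: fh.
Qed.

Lemma pderivable_eq_on U f h x : open U -> U x ->
  (forall y, U y -> f y = h y) -> pderivable f x -> pderivable h x.
Proof.
move=> oU Ux fh df a; apply: near_eq_derivable (df a).
by apply: filterS (open_nbhs_nbhs (conj oU Ux)) => y; exact: fh.
Qed.

Lemma smooth_on_pderivable U f x : smooth_on U f -> U x -> pderivable f x.
Proof. by move=> sf Ux a; have [_ /(_ a)[+ _]] := sf 1%N; exact. Qed.

Lemma smooth_on_partial U f a : smooth_on U f -> smooth_on U (partial a f).
Proof. by move=> sf k; have [_ /(_ a)[]] := sf k.+1. Qed.

Lemma smooth_on_continuous U f x : smooth_on U f -> U x ->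
  {for x, continuous f}.
Proof. by move=> sf Ux; have [+ _] := sf 0%N; apply; rewrite inE. Qed.

Lemma partialC U f a b x : open U -> U x -> smooth_on U f ->
  partial a (partial b f) x = partial b (partial a f) x.
Proof.
move=> oU Ux sf.
apply: (@is_derive_comm R _ U f (partial b f) (partial a f)
  (partial a (partial b f)) (partial b (partial a f)) x
  (delta_mx 0 b) (delta_mx 0 a) oU Ux).
- move=> y Uy; split; apply: derivableP.
  + exact: (smooth_on_pderivable sf Uy).
  + exact: (smooth_on_pderivable sf Uy).
  + exact: (@smooth_on_pderivable _ (partial b f) y (smooth_on_partial b sf) Uy _).
  + exact: (@smooth_on_pderivable _ (partial a f) y (smooth_on_partial a sf) Uy _).
- by apply: (smooth_on_continuous _ Ux); do 2 apply: smooth_on_partial.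
- by apply: (smooth_on_continuous _ Ux); do 2 apply: smooth_on_partial.
Qed.

Lemma continuous_eq_on U f h : open U -> (forall y, U y -> f y = h y) ->
  {in U, continuous f} -> {in U, continuous h}.
Proof.
move=> oU fh cf y; rewrite inE => Uy; rewrite /continuous_at -(fh y Uy).
have E : \forall z \near nbhs y, f z = h z.
  by apply: filterS (open_nbhs_nbhs (conj oU Uy)) => z; exact: fh.
exact: cvg_trans (near_eq_cvg E) (cf y (mem_set Uy)).
Qed.

(** On an open set partial derivatives depend on the values there only, so the induction passes to
    [partial a]. This later transfers smoothness from [h] to [CKY_h]. *)
Lemma smooth_on_eq U f h : open U -> (forall y, U y -> f y = h y) ->
  smooth_on U f -> smooth_on U h.
Proof.
move=> oU fh sf k; move: (sf k); elim: k f h fh {sf} => [|k IH] f h fh [cf df].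
  by split=> //; exact: continuous_eq_on fh cf.
split; first exact: continuous_eq_on fh cf.
move=> a.
have [d1 d2] := df a; split.
  move=> y Uy; apply: near_eq_derivable (d1 y Uy).
  by apply: filterS (open_nbhs_nbhs (conj oU Uy)) => z; exact: fh.
apply: IH d2 => y Uy; exact: partial_eq_on fh.
Qed.

Lemma pderivable_det m (A : 'rV[R]_n -> 'M[R]_m) x :
  (forall i j, pderivable (fun y => A y i j) x) ->
  pderivable (fun y => \det (A y)) x.
Proof.
move=> dA; apply: pderivable_sum => s _.
apply: pderivableM; first exact: pderivable_cst.
by apply: pderivable_prod => i _; exact: dA.
Qed.

(** Cramer's rule: on [U] the entries are cofactors over the determinant, all polynomial in the
    entries of [A]. *)
Lemma pderivable_invmx U m (A : 'rV[R]_n -> 'M[R]_m) x i j :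
  open U -> U x -> (forall y, U y -> A y \in unitmx) ->
  (forall i j, pderivable (fun y => A y i j) x) ->
  pderivable (fun y => invmx (A y) i j) x.
Proof.
move=> oU Ux uA dA.
apply: (@pderivable_eq_on U (fun y => (\det (A y))^-1 * cofactor (A y) j i)) => //.
  by move=> y Uy; rewrite /invmx uA// !mxE.
apply: pderivableM.
  apply: pderivableV; last exact: pderivable_det.
  by rewrite -unitfE -unitmxE uA.
apply: pderivableM; first exact: pderivable_cst.
apply: pderivable_det => k l.
have -> : (fun y => row' j (col' i (A y)) k l) =
  (fun y => A y (lift j k) (lift i l)) by apply/funext => y; rewrite !mxE.
exact: dA.
Qed.

End Partial.

(** * Tensors and the Levi-Civita connection in a patch *)

Section MultiIndex.
Context {n : nat}.
Implicit Types a b c d f : 'I_n.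

Lemma tnth_tsubst k (E : k.-tuple 'I_n) i f j :
  tnth (tsubst E i f) j = if j == i then f else tnth E j.
Proof. exact: tnth_mktuple. Qed.

Lemma tnth_tperm_idx k (E : k.-tuple 'I_n) (s : 'S_k) j :
  tnth (tperm_idx E s) j = tnth E (s j).
Proof. exact: tnth_mktuple. Qed.

Lemma tsubst_id k (E : k.-tuple 'I_n) i : tsubst E i (tnth E i) = E.
Proof.
by apply: eq_from_tnth => j; rewrite tnth_tsubst; case: eqVneq => [->|].
Qed.

Lemma tsubst_same k (E : k.-tuple 'I_n) i c d :
  tsubst (tsubst E i c) i d = tsubst E i d.
Proof.
by apply: eq_from_tnth => j; rewrite !tnth_tsubst; case: eqVneq.
Qed.

Lemma tsubstC k (E : k.-tuple 'I_n) i j c d : i != j ->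
  tsubst (tsubst E i c) j d = tsubst (tsubst E j d) i c.
Proof.
move=> ij; apply: eq_from_tnth => l; rewrite !tnth_tsubst.
by case: (eqVneq l j) => // ->; rewrite eq_sym (negbTE ij).
Qed.

Lemma tsubst_tperm_idx k (E : k.-tuple 'I_n) (s : 'S_k) i c :
  tsubst (tperm_idx E s) i c = tperm_idx (tsubst E (s i) c) s.
Proof.
apply: eq_from_tnth => j; rewrite !tnth_tsubst !tnth_tperm_idx tnth_tsubst.
by rewrite (inj_eq perm_inj).
Qed.

Lemma tnth_lift0 k b (B : k.-tuple 'I_n) i :
  tnth [tuple of b :: B] (lift ord0 i) = tnth B i.
Proof. by rewrite !(tnth_nth b). Qed.

Lemma tsubst_cons0 k b (B : k.-tuple 'I_n) c :
  tsubst [tuple of b :: B] ord0 c = [tuple of c :: B].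
Proof.
apply: eq_from_tnth => j; rewrite tnth_tsubst.
by case: (unliftP ord0 j) => [l ->|->]; rewrite ?tnth_lift0.
Qed.

Lemma tsubst_consS k b (B : k.-tuple 'I_n) i c :
  tsubst [tuple of b :: B] (lift ord0 i) c = [tuple of b :: tsubst B i c].
Proof.
apply: eq_from_tnth => j; rewrite tnth_tsubst.
case: (unliftP ord0 j) => [l ->|->]; last by [].
by rewrite !tnth_lift0 tnth_tsubst (inj_eq lift_inj).
Qed.

Lemma tuple2E (B : 2.-tuple 'I_n) : B = [tuple tnth B ord0; tnth B ord_max].
Proof.
apply: eq_from_tnth => j; rewrite [RHS](tnth_nth (tnth B ord0)).
by case: j => -[|[|]] //= ?; congr (tnth B _); apply: val_inj.
Qed.

Lemma tsubst_pair0 b c m : tsubst [tuple b; c] ord0 m = [tuple m; c].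
Proof.
apply: eq_from_tnth => j; rewrite tnth_tsubst !(tnth_nth b).
by case: j => -[|[|]].
Qed.

Lemma tsubst_pair1 b c m :
  tsubst [tuple b; c] (lift ord0 ord0) m = [tuple b; m].
Proof.
apply: eq_from_tnth => j; rewrite tnth_tsubst !(tnth_nth b).
by case: j => -[|[|]].
Qed.

End MultiIndex.

(** * Matrices acting slot by slot on covariant tensors *)

Section SlotAction.
Context {R : realType} {n k : nat}.
Implicit Types (A : 'I_n -> 'I_n -> R) (T : k.-tuple 'I_n -> R).

(* The derivation action of gl_n on covariant tensors, with the opposite sign;
   [nabla] subtracts it for A^c_b = Gamma^c_{ab}. *)
Definition slot_action A T (B : k.-tuple 'I_n) : R :=
  \sum_(i < k) \sum_c A c (tnth B i) * T (tsubst B i c).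

Lemma eq_slot_action A A' T T' : A =2 A' -> T =1 T' ->
  slot_action A T =1 slot_action A' T'.
Proof.
by move=> eA eT B; apply: eq_bigr => i _; apply: eq_bigr => c _; rewrite eA eT.
Qed.

Lemma slot_actionDr A T T' B :
  slot_action A (fun C => T C + T' C) B = slot_action A T B + slot_action A T' B.
Proof.
rewrite -big_split; apply: eq_bigr => i _ /=.
by rewrite -big_split; apply: eq_bigr => c _ /=; rewrite mulrDr.
Qed.

Lemma slot_actionBr A T T' B :
  slot_action A (fun C => T C - T' C) B = slot_action A T B - slot_action A T' B.
Proof.
rewrite -sumrB; apply: eq_bigr => i _ /=.
by rewrite -sumrB; apply: eq_bigr => c _ /=; rewrite mulrBr.
Qed.

Lemma slot_actionBl A A' T B :
  slot_action (fun c b => A c b - A' c b) T B =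
  slot_action A T B - slot_action A' T B.
Proof.
rewrite -sumrB; apply: eq_bigr => i _ /=.
by rewrite -sumrB; apply: eq_bigr => c _ /=; rewrite mulrBl.
Qed.

(** When both matrices meet the same slot they compose to a matrix product; the double sum collects
    the pairs of different slots. *)
Lemma slot_action2 A A' T B :
  slot_action A (slot_action A' T) B =
  slot_action (fun d b => \sum_c A' d c * A c b) T B +
  \sum_(i < k) \sum_(j < k | j != i) \sum_c \sum_d
    A c (tnth B i) * A' d (tnth B j) * T (tsubst (tsubst B i c) j d).
Proof.
rewrite -big_split; apply: eq_bigr => i _ /=.
under [X in X + _]eq_bigr do rewrite mulr_suml.
rewrite [X in X + _]exchange_big [X in _ + X]exchange_big -big_split /=.
apply: eq_bigr => c _.
rewrite mulr_sumr (bigD1 i)//=; congr (_ + _).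
  rewrite mulr_sumr; apply: eq_bigr => d _.
  by rewrite tnth_tsubst eqxx tsubst_same mulrA (mulrC (A c _)).
apply: eq_bigr => j ji; rewrite mulr_sumr; apply: eq_bigr => d _.
by rewrite tnth_tsubst (negbTE ji) mulrA.
Qed.

(** Replacements in different slots commute, so those parts cancel. The matrix commutator that is
    left supplies the quadratic part of the curvature. *)
Lemma slot_action_commutator A A' T B :
  slot_action A (slot_action A' T) B - slot_action A' (slot_action A T) B =
  slot_action (fun d b => \sum_c (A' d c * A c b - A d c * A' c b)) T B.
Proof.
rewrite !slot_action2 opprD addrACA -slot_actionBl.
rewrite [X in _ + X](_ : _ = 0) ?addr0.
  by apply: eq_slot_action => // d b; rewrite sumrB.
apply/eqP; rewrite subr_eq0; apply/eqP.
rewrite (exchange_big_dep predT)//=; apply: eq_bigr => i _.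
apply: eq_big => [j|j ji]; first by rewrite eq_sym.
rewrite exchange_big; apply: eq_bigr => c _; apply: eq_bigr => d _.
by rewrite tsubstC 1?eq_sym// (mulrC (A _ _)).
Qed.

End SlotAction.

(** * The Levi-Civita connection, the Ricci identity and the symmetries of the curvature *)

Section LeviCivita.
Context {R : realType} {n : nat} (U : set 'rV[R]_n) (g : comps R n 2).
Hypothesis oU : open U.
Hypothesis sg : forall B, smooth_on U (g B).
Hypothesis gC : forall x, U x -> forall a b, g [tuple a; b] x = g [tuple b; a] x.
Hypothesis gunit : forall x, U x -> gmx g x \in unitmx.
Implicit Types (a b c d e f : 'I_n) (x : 'rV[R]_n).

Lemma pderivable_christoffel c a b x : U x -> pderivable (christoffel g c a b) x.
Proof.
move=> Ux; apply: pderivableM; first exact: pderivable_cst.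
apply: pderivable_sum => d _; apply: pderivableM.
  apply: (@pderivable_invmx _ _ U _ (gmx g) x c d oU Ux gunit) => i j.
  have -> : (fun y => gmx g y i j) = g [tuple i; j].
    by apply/funext => y; rewrite mxE.
  exact: smooth_on_pderivable (sg _) Ux.
have dg B e : pderivable (partial e (g B)) x.
  exact: smooth_on_pderivable (smooth_on_partial e (sg B)) Ux.
by apply: pderivableB => //; apply: pderivableD.
Qed.

Lemma partial_metricC c a b x : U x ->
  partial c (g [tuple a; b]) x = partial c (g [tuple b; a]) x.
Proof. by move=> Ux; apply: partial_eq_on oU Ux _ => y Uy; exact: gC. Qed.

Lemma christoffelC c a b x : U x -> christoffel g c a b x = christoffel g c b a x.
Proof.
move=> Ux; congr (_ * _); apply: eq_bigr => d _; congr (_ * _).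
by rewrite (partial_metricC d a) // (addrC (partial a _ _)).
Qed.

Lemma partial_christoffelC e c a b x : U x ->
  partial e (christoffel g c a b) x = partial e (christoffel g c b a) x.
Proof. by move=> Ux; apply: partial_eq_on oU Ux _ => y; exact: christoffelC. Qed.

Lemma ginvC a b x : U x -> ginv g a b x = ginv g b a x.
Proof.
move=> Ux; rewrite /ginv; have GT : (gmx g x)^T = gmx g x.
  by apply/matrixP => i j; rewrite !mxE gC.
by rewrite -{1}GT -trmx_inv mxE.
Qed.

Lemma ginvM a b x : U x ->
  \sum_c ginv g a c x * g [tuple c; b] x = (a == b)%:R.
Proof.
move=> Ux; have /matrixP/(_ a b) := mulVmx (gunit Ux); rewrite !mxE => <-.
by apply: eq_bigr => c _; rewrite [gmx g x c b]mxE.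
Qed.

Lemma lower_raise (F : 'I_n -> R) b x : U x ->
  \sum_m (\sum_d ginv g m d x * F d) * g [tuple m; b] x = F b.
Proof.
move=> Ux; under eq_bigr do rewrite mulr_suml.
rewrite exchange_big /= (bigD1 b)//= [X in _ + X]big1 ?addr0.
  transitivity (F b * (b == b)%:R); last by rewrite eqxx mulr1.
  rewrite -(ginvM b b Ux) mulr_sumr; apply: eq_bigr => m _.
  by rewrite (ginvC m) //; ring.
move=> d db; transitivity (F d * (d == b)%:R).
  2: by rewrite (negbTE db) mulr0.
rewrite -(ginvM d b Ux) mulr_sumr; apply: eq_bigr => m _.
by rewrite (ginvC m) //; ring.
Qed.

Lemma lower_christoffel c a b x : U x ->
  \sum_m christoffel g m c a x * g [tuple m; b] x =
  2^-1 * (partial c (g [tuple a; b]) x + partial a (g [tuple c; b]) x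
          - partial b (g [tuple c; a]) x).
Proof.
move=> Ux; rewrite -(lower_raise (fun d => partial c (g [tuple a; d]) x +
  partial a (g [tuple c; d]) x - partial d (g [tuple c; a]) x) b Ux) mulr_sumr.
by apply: eq_bigr => m _; rewrite mulrA.
Qed.

(** Metric compatibility: two Koszul formulas for the lowered Christoffel symbols add up to a single
    derivative of the metric. *)
Lemma partial_metric c a b x : U x -> partial c (g [tuple a; b]) x =
  \sum_m christoffel g m c a x * g [tuple m; b] x +
  \sum_m christoffel g m c b x * g [tuple a; m] x.
Proof.
move=> Ux; under [X in _ + X]eq_bigr do rewrite (gC Ux a).
rewrite !lower_christoffel // (partial_metricC c b) //.
by rewrite (partial_metricC b c) // (partial_metricC b a) //; lra.
Qed.

Lemma nablaE k (T : comps R n k) a B x :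
  nabla g T a B x =
  partial a (T B) x - slot_action (fun c b => christoffel g c a b x) (T ^~ x) B.
Proof. by []. Qed.

Lemma nabla_metric a B x : U x -> nabla g g a B x = 0.
Proof.
move=> Ux; rewrite (tuple2E B); move: (tnth B _) (tnth B _) => b c.
rewrite /nabla partial_metric // !big_ord_recl big_ord0 addr0 /=.
apply/eqP; rewrite subr_eq0; apply/eqP; congr (_ + _); apply: eq_bigr => m _.
  by rewrite tsubst_pair0.
by rewrite tsubst_pair1.
Qed.

Section RicciIdentity.
Context {k : nat} (T : comps R n k).
Hypothesis sT : forall B, smooth_on U (T B).

Lemma pderivable_slot_action a B x : U x ->
  pderivable (fun y => slot_action (fun c b => christoffel g c a b y) (T ^~ y) B) x.
Proof.
move=> Ux; apply: pderivable_sum => i _; apply: pderivable_sum => c _.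
apply: pderivableM; first exact: pderivable_christoffel.
exact: smooth_on_pderivable (sT _) Ux.
Qed.

Lemma pderivable_nabla a B x : U x -> pderivable (nabla g T a B) x.
Proof.
move=> Ux; apply: pderivableB; last exact: pderivable_slot_action.
exact: smooth_on_pderivable (smooth_on_partial a (sT B)) Ux.
Qed.

Lemma partial_nabla a b B x : U x -> partial a (nabla g T b B) x =
  partial a (partial b (T B)) x
  - (slot_action (fun c d => partial a (christoffel g c b d) x) (T ^~ x) B
     + slot_action (fun c d => christoffel g c b d x)
         (fun C => partial a (T C) x) B).
Proof.
move=> Ux; rewrite partialB; first last.
- exact: pderivable_slot_action.
- exact: smooth_on_pderivable (smooth_on_partial b (sT B)) Ux.
have dT C : pderivable (T C) x by exact: smooth_on_pderivable (sT C) Ux.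
congr (_ - _).
have dM c d C : pderivable (fun y => christoffel g c b d y * T C y) x.
  by apply: pderivableM => //; exact: pderivable_christoffel.
rewrite partial_sum => [|i _]; last by apply: pderivable_sum => c _.
rewrite -big_split; apply: eq_bigr => i _ /=.
rewrite partial_sum => [|c _] //.
rewrite -big_split; apply: eq_bigr => c _ /=.
by rewrite partialM //; exact: pderivable_christoffel.
Qed.

(** Second partial derivatives cancel by [partialC] and the mixed terms cancel in pairs. Derivatives
    of the Christoffel symbols and the commutator of slot actions remain, which is [riemann_up].
    Here [a] and [b] are mere labels, without Christoffel terms of their own. *)
Lemma ricci_identity a b B x : U x ->
  nabla g (nabla g T b) a B x - nabla g (nabla g T a) b B x =
  - \sum_(i < k) \sum_f riemann_up g a b (tnth B i) f x * T (tsubst B i f) x.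
Proof.
move=> Ux; rewrite (nablaE (nabla g T b)) (nablaE (nabla g T a)).
rewrite !partial_nabla // (partialC a b oU Ux (sT B)).
have E c A C : slot_action A (fun C => nabla g T c C x) C =
    slot_action A (fun C => partial c (T C) x) C -
    slot_action A (slot_action (fun c' b => christoffel g c' c b x) (T ^~ x)) C.
  by rewrite -slot_actionBr.
rewrite !E.
set pab := partial b _ x; set Ga := fun c' b => christoffel g c' a b x.
set Gb := fun c' d => christoffel g c' b d x.
have := slot_action_commutator Ga Gb (T ^~ x) B.
have -> : \sum_(i < k) \sum_f riemann_up g a b (tnth B i) f x * T (tsubst B i f) x =
  slot_action (fun f d => riemann_up g a b d f x) (T ^~ x) B by [].
have -> : slot_action (fun f d => riemann_up g a b d f x) (T ^~ x) B =
  slot_action (fun c d => partial a (christoffel g c b d) x) (T ^~ x) B -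
  slot_action (fun c d => partial b (christoffel g c a d) x) (T ^~ x) B -
  slot_action (fun d c => \sum_e (Gb d e * Ga e c - Ga d e * Gb e c)) (T ^~ x) B.
  rewrite -!slot_actionBl; apply: eq_slot_action => // c d.
  rewrite /riemann_up; congr (_ + _); rewrite -sumrN; apply: eq_bigr => e _.
  by rewrite opprB.
move=> <-.
have alg (p s t u v s' v' : R) :
  p - (s + t) - (u - v) - (p - (s' + u) - (t - v')) = - (s - s' - (v - v')).
  by ring.
exact: alg.
Qed.

End RicciIdentity.

Lemma riemann_upC a b c d x : riemann_up g a b c d x = - riemann_up g b a c d x.
Proof.
rewrite /riemann_up opprD opprB; congr (_ + _).
by rewrite -sumrN; apply: eq_bigr => e _; rewrite opprB.
Qed.

(** Since the connection is torsion free, the derivative terms [P] and the products [S] are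
    symmetric in their last two indices, and the cyclic sum cancels. *)
Lemma riemann_up_bianchi a b c d x : U x ->
  riemann_up g a b c d x + riemann_up g b c a d x + riemann_up g c a b d x = 0.
Proof.
move=> Ux.
pose P p q r := partial p (christoffel g d q r) x.
pose S p q r := \sum_e christoffel g d p e x * christoffel g e q r x.
have PC p q r : P p q r = P p r q by exact: partial_christoffelC.
have SC p q r : S p q r = S p r q.
  by apply: eq_bigr => e _; rewrite (christoffelC e).
have E p q r : riemann_up g p q r d x = P p q r - P q p r + (S p q r - S q p r).
  by rewrite /riemann_up sumrB.
rewrite !E; clearbody P S.
rewrite (PC b c) (PC a c) (PC c b) (SC b c) (SC a c) (SC c b); ring.
Qed.

Lemma riemannC12 a b c d x : riemann g a b c d x = - riemann g b a c d x.
Proof.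
by rewrite -sumrN; apply: eq_bigr => e _; rewrite riemann_upC mulrN.
Qed.

Lemma riemann_bianchi a b d c x : U x ->
  riemann g a b c d x + riemann g b d c a x + riemann g d a c b x = 0.
Proof.
move=> Ux; rewrite -!big_split big1 // => e _ /=.
by rewrite -!mulrDr riemann_up_bianchi // mulr0.
Qed.

(** In the Ricci identity for the parallel tensor [g] the left side vanishes, and the right side
    symmetrizes the curvature in its last pair. *)
Lemma riemannC34 a b c d x : U x -> riemann g a b c d x = - riemann g a b d c x.
Proof.
move=> Ux; have := ricci_identity sg a b [tuple c; d] Ux.
have N e f y : U y -> nabla g (nabla g g e) f [tuple c; d] y = 0.
  move=> Uy; rewrite nablaE (@partial_eq_on _ _ U _ (fun=> 0) f y)//.
    rewrite partial_cst /slot_action big1 ?subrr// => i _.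
    by rewrite big1 // => m _; rewrite nabla_metric // mulr0.
  by move=> z Uz; rewrite nabla_metric.
rewrite !N // subrr !big_ord_recl big_ord0 addr0 => /esym/eqP.
rewrite oppr_eq0 addr_eq0 => /eqP E.
transitivity (\sum_f riemann_up g a b d f x * g [tuple c; f] x).
  by apply: eq_bigr => f _; rewrite mulrC.
apply: (canRL (@opprK _)); transitivity
  (\sum_f riemann_up g a b (tnth [tuple c; d] ord0) f x
    * g (tsubst [tuple c; d] ord0 f) x).
  by rewrite E; congr (- _); apply: eq_bigr => f _; rewrite tsubst_pair1.
by apply: eq_bigr => f _; rewrite tsubst_pair0 mulrC (gC Ux f).
Qed.

(** A linear combination of four Bianchi identities, one for each choice of the index left fixed by
    the cyclic sum. *)
Lemma riemann_pairC a b c d x : U x -> riemann g a b c d x = riemann g c d a b x.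
Proof.
move=> Ux.
have := riemann_bianchi a b d c Ux; have := riemann_bianchi a b c d Ux.
have := riemann_bianchi b c d a Ux; have := riemann_bianchi a c d b Ux.
have C12 e f e' f' := riemannC12 e f e' f' x.
have C34 e f e' f' := riemannC34 e f e' f' Ux.
move: (riemann g) C12 C34 => Rm C12 C34.
rewrite (C34 a b d c) (C12 b d) (C34 d b c a) (C34 d a b c) (C34 b c a d).
rewrite (C12 a c) (C34 c a b d) (C34 c d b a); lra.
Qed.

Lemma riemann_up_raise a b d e x : U x ->
  riemann_up g a b d e x = \sum_c ginv g e c x * riemann g a b c d x.
Proof.
move=> Ux; under eq_bigr do rewrite mulr_sumr.
rewrite exchange_big /= (bigD1 e)//= [X in _ + X]big1 ?addr0 => [|f fe].
  under eq_bigr do rewrite mulrA.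
  by rewrite -mulr_suml ginvM // eqxx mul1r.
under eq_bigr do rewrite mulrA.
by rewrite -mulr_suml ginvM // eq_sym (negbTE fe) mul0r.
Qed.

End LeviCivita.

(** * Slot actions under permutation, splitting and replacement of indices *)

Section SlotActionExtra.
Context {R : realType} {n : nat}.
Implicit Types (A : 'I_n -> 'I_n -> R).

Definition skew k (T : k.-tuple 'I_n -> R) : Prop :=
  forall B (s : 'S_k), T (tperm_idx B s) = (-1) ^+ s * T B.

Lemma slot_action_skew k A (T : k.-tuple 'I_n -> R) :
  skew T -> skew (slot_action A T).
Proof.
move=> skT B s; rewrite /slot_action [in RHS](reindex_inj (@perm_inj _ s)) /=.
rewrite mulr_sumr; apply: eq_bigr => i _; rewrite mulr_sumr.
apply: eq_bigr => c _.
by rewrite tnth_tperm_idx tsubst_tperm_idx skT mulrCA.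
Qed.

Lemma slot_action_cons k A (T : k.+1.-tuple 'I_n -> R) b (B : k.-tuple 'I_n) :
  slot_action A T [tuple of b :: B] =
  \sum_m A m b * T [tuple of m :: B] +
  slot_action A (fun C => T [tuple of b :: C]) B.
Proof.
rewrite /slot_action big_ord_recl; congr (_ + _).
  by apply: eq_bigr => m _; rewrite tsubst_cons0.
apply: eq_bigr => i _; apply: eq_bigr => m _.
by rewrite tnth_lift0 tsubst_consS.
Qed.

Lemma slot_action_scale k A (T : k.-tuple 'I_n -> R) (l : R) B :
  slot_action A (fun C => l * T C) B = l * slot_action A T B.
Proof.
rewrite mulr_sumr; apply: eq_bigr => i _; rewrite mulr_sumr.
by apply: eq_bigr => c _; rewrite mulrCA.
Qed.

Lemma slot_action_sum k A I (r : seq I) (T : I -> k.-tuple 'I_n -> R) B :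
  slot_action A (fun C => \sum_(i <- r) T i C) B =
  \sum_(i <- r) slot_action A (T i) B.
Proof.
rewrite /slot_action [RHS]exchange_big; apply: eq_bigr => i _ /=.
by rewrite [RHS]exchange_big; apply: eq_bigr => c _ /=; rewrite mulr_sumr.
Qed.

(** Both sides are the derivation rule for [G (tnth B i) * T (tsubst B i b)], grouped once by the
    two factors and once by the indices [B] and [b]. *)
Lemma slot_action_subst k A (G : 'I_n -> R) (T : k.-tuple 'I_n -> R) B i b :
  G (tnth B i) * slot_action A T (tsubst B i b) +
  \sum_m A m (tnth B i) * (G m * T (tsubst B i b)) =
  slot_action A (fun C => G (tnth C i) * T (tsubst C i b)) B +
  \sum_m A m b * (G (tnth B i) * T (tsubst B i m)).
Proof.
rewrite /slot_action (bigD1 i)//= [in RHS](bigD1 i)//=.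
rewrite mulrDr addrAC [RHS]addrAC; congr (_ + _).
  rewrite addrC mulr_sumr; congr (_ + _); apply: eq_bigr => m _.
    by rewrite tnth_tsubst eqxx tsubst_same.
  by rewrite tnth_tsubst eqxx tsubst_same mulrCA.
rewrite mulr_sumr; apply: eq_bigr => j ji; rewrite mulr_sumr.
apply: eq_bigr => m _; rewrite !tnth_tsubst (negbTE ji) eq_sym (negbTE ji).
by rewrite (@tsubstC _ _ B j i) // mulrCA.
Qed.

End SlotActionExtra.

(** * The differentiated conformal Killing-Yano equation *)

Section CovariantDerivative.
Context {R : realType} {n : nat} (U : set 'rV[R]_n) (g : comps R n 2).
Hypothesis oU : open U.
Hypothesis sg : forall B, smooth_on U (g B).
Hypothesis gC : forall x, U x -> forall a b, g [tuple a; b] x = g [tuple b; a] x.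
Hypothesis gunit : forall x, U x -> gmx g x \in unitmx.
Implicit Types (a b c d : 'I_n) (x : 'rV[R]_n).

Lemma nabla_eq_on k (T T' : comps R n k) a B x : U x ->
  (forall C y, U y -> T C y = T' C y) -> nabla g T a B x = nabla g T' a B x.
Proof.
move=> Ux E; rewrite !nablaE; congr (_ - _).
  by apply: partial_eq_on oU Ux _; exact: E.
by apply: eq_slot_action => // C; exact: E.
Qed.

Lemma skew_nabla k (T : comps R n k) a x :
  (forall B y, U y -> pderivable (T B) y) -> U x ->
  (forall y, U y -> skew (T ^~ y)) -> skew (fun B => nabla g T a B x).
Proof.
move=> dT Ux skT B s; rewrite !nablaE mulrBr slot_action_skew; last exact: skT.
congr (_ - _); rewrite (@partial_eq_on _ _ U _ (fun y => (-1) ^+ s * T B y))//.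
  rewrite partialM; [|exact: pderivable_cst|exact: dT].
  by rewrite partial_cst mul0r add0r.
by move=> y Uy; exact: skT.
Qed.

(* Second covariant derivative nabla_c nabla_a T_B: [nabla g (nabla g T a) c]
   alone ignores the index [a]. *)
Definition nabla2 k (T : comps R n k) c a B x : R :=
  nabla g (nabla g T a) c B x - \sum_m christoffel g m c a x * nabla g T m B x.

(** The correction for the differentiated index is symmetric in [a], [b] because the connection is
    torsion free, so it drops out of the commutator. *)
Lemma nabla2_ricci k (T : comps R n k) a b B x :
  (forall C, smooth_on U (T C)) -> U x ->
  nabla2 T a b B x - nabla2 T b a B x =
  - \sum_(i < k) \sum_f riemann_up g a b (tnth B i) f x * T (tsubst B i f) x.
Proof.
move=> sT Ux; rewrite -(ricci_identity oU sg gunit sT) // /nabla2.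
under [X in _ - _ - (_ - X)]eq_bigr do rewrite (christoffelC oU gC _ b a) //.
have alg (p q r : R) : p - r - (q - r) = p - q by ring.
exact: alg.
Qed.

Lemma skew_nabla2 k (T : comps R n k) c a x :
  (forall C, smooth_on U (T C)) -> U x ->
  (forall y, U y -> skew (T ^~ y)) -> skew (fun B => nabla2 T c a B x).
Proof.
move=> sT Ux skT B s; rewrite /nabla2 mulrBr.
have dT C y : U y -> pderivable (T C) y by exact: smooth_on_pderivable.
congr (_ - _).
  apply: skew_nabla => [C y Uy||y Uy]; [|exact: Ux|exact: skew_nabla].
  exact: (pderivable_nabla oU sg gunit sT).
rewrite mulr_sumr; apply: eq_bigr => m _.
by rewrite (@skew_nabla _ T m x dT Ux skT B s) mulrCA.
Qed.

Section ThreeSlots.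
Context {k : nat}.
Implicit Types (e : 'I_n -> 'I_n -> comps R n k) (h : comps R n k).

(* The covariant derivative of a tensor e_{abB} of rank k + 2. *)
Definition nabla3 e c a b B x : R :=
  partial c (e a b B) x
  - \sum_m christoffel g m c a x * e m b B x
  - \sum_m christoffel g m c b x * e a m B x
  - slot_action (fun m d => christoffel g m c d x) (fun C => e a b C x) B.

Lemma nabla3_eq_on e e' c a b B x : U x ->
  (forall a b C y, U y -> e a b C y = e' a b C y) ->
  nabla3 e c a b B x = nabla3 e' c a b B x.
Proof.
move=> Ux E; rewrite /nabla3; congr (_ - _); last first.
  by apply: eq_slot_action => // C; exact: E.
congr (_ - _); last by apply: eq_bigr => m _; rewrite E.
congr (_ - _); last by apply: eq_bigr => m _; rewrite E.
by apply: partial_eq_on oU Ux _; exact: E.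
Qed.

Lemma nabla3_swap e c a b B x :
  nabla3 (fun a b => e b a) c a b B x = nabla3 e c b a B x.
Proof. by rewrite /nabla3; congr (_ - _); rewrite addrAC. Qed.

Lemma nabla3D e e' c a b B x : (forall a b C, pderivable (e a b C) x) ->
  (forall a b C, pderivable (e' a b C) x) ->
  nabla3 (fun a b C y => e a b C y + e' a b C y) c a b B x =
  nabla3 e c a b B x + nabla3 e' c a b B x.
Proof.
move=> de de'; rewrite /nabla3 partialD // slot_actionDr.
under eq_bigr do rewrite mulrDr.
under [X in _ - X - _]eq_bigr do rewrite mulrDr.
rewrite !big_split /=.
have alg (p p' q q' r r' s s' : R) : p + p' - (q + q') - (r + r') - (s + s') =
  p - q - r - s + (p' - q' - r' - s') by ring.
exact: alg.
Qed.

Lemma nabla3_scale e (l : R) c a b B x : (forall a b C, pderivable (e a b C) x) ->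
  nabla3 (fun a b C y => l * e a b C y) c a b B x = l * nabla3 e c a b B x.
Proof.
move=> de; rewrite /nabla3 partialM //.
rewrite partial_cst mul0r add0r slot_action_scale !mulrBr !mulr_sumr.
by congr (_ - _ - _ - _); apply: eq_bigr => m _; rewrite mulrCA.
Qed.

Lemma nabla3_sum I (r : seq I) (e : I -> 'I_n -> 'I_n -> comps R n k) c a b B x :
  (forall i a b C, pderivable (e i a b C) x) ->
  nabla3 (fun a b C y => \sum_(i <- r) e i a b C y) c a b B x =
  \sum_(i <- r) nabla3 (e i) c a b B x.
Proof.
move=> de; rewrite /nabla3 partial_sum // slot_action_sum !sumrB.
congr (_ - _ - _ - _).
  by rewrite exchange_big; apply: eq_bigr => m _; rewrite mulr_sumr.
by rewrite exchange_big; apply: eq_bigr => m _; rewrite mulr_sumr.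
Qed.

Lemma nabla3_metric h c a b B x : U x -> (forall C, pderivable (h C) x) ->
  nabla3 (fun a b C y => g [tuple a; b] y * h C y) c a b B x =
  g [tuple a; b] x * nabla g h c B x.
Proof.
move=> Ux dh; rewrite /nabla3 partialM //.
2: exact: smooth_on_pderivable (sg _) Ux.
rewrite slot_action_scale nablaE (partial_metric oU gC gunit c a b Ux).
under [X in _ - X - _ - _]eq_bigr do rewrite mulrA.
under [X in _ - _ - X - _]eq_bigr do rewrite mulrA.
rewrite -!mulr_suml mulrDl.
have alg (p q r s G : R) : p + q + G * r - p - q - G * s = G * (r - s) by ring.
exact: alg.
Qed.

(** As [b] sits in slot [i] of [h], [slot_action_subst] first regroups the Christoffel terms by
    factors; those of the metric then cancel its derivative. *)
Lemma nabla3_metric_subst h i c a b B x : U x ->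
  (forall C, pderivable (h C) x) ->
  nabla3 (fun a b C y => g [tuple a; tnth C i] y * h (tsubst C i b) y) c a b B x =
  g [tuple a; tnth B i] x * nabla g h c (tsubst B i b) x.
Proof.
move=> Ux dh; rewrite /nabla3 partialM //.
2: exact: smooth_on_pderivable (sg _) Ux.
rewrite nablaE (partial_metric oU gC gunit c a _ Ux).
have := slot_action_subst (fun m d => christoffel g m c d x)
  (fun m => g [tuple a; m] x) (h ^~ x) B i b.
under [X in _ + X = _]eq_bigr do rewrite mulrA.
under [X in _ - X - _ - _]eq_bigr do rewrite mulrA.
rewrite -!mulr_suml mulrDl mulrBr.
have alg (p q r t u v : R) : v + q = u + t ->
  p + q + r - p - t - u = r - v.
  by move=> E; have -> : q = u + t - v by [rewrite -E; ring]; ring.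
move=> Es; exact: alg Es.
Qed.

End ThreeSlots.

Lemma nabla2_cons k (T : comps R n k.+1) c a b (B : k.-tuple 'I_n) x :
  nabla2 T c a [tuple of b :: B] x =
  nabla3 (fun a b C => nabla g T a [tuple of b :: C]) c a b B x.
Proof.
rewrite /nabla2 nablaE slot_action_cons /nabla3 opprD addrA.
rewrite -[LHS]addrA [X in _ + X = _]addrC addrA; congr (_ - _).
by rewrite addrAC.
Qed.

(* p g_{a[b}h_{B]} + p g_{b[a}h_{B]} for skew h, p being one more than the rank
   of h. *)
Definition sym_wedge k (G : 'I_n -> 'I_n -> R) (h : k.-tuple 'I_n -> R) a b B : R :=
  2 * (G a b * h B) - \sum_(i < k) (G a (tnth B i) * h (tsubst B i b)
                                  + G b (tnth B i) * h (tsubst B i a)).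

Let G y a b := g [tuple a; b] y.

(** The equation holds on the open set [U] and may be differentiated there; the metric being
    parallel, the derivative falls on [h] alone. *)
Lemma nabla2_CKY k (T : comps R n k.+1) (h : comps R n k) (l : R) c a b
    (B : k.-tuple 'I_n) x :
  (forall C, smooth_on U (T C)) -> (forall C, smooth_on U (h C)) -> U x ->
  (forall y, U y -> forall a b (C : k.-tuple 'I_n),
    nabla g T a [tuple of b :: C] y + nabla g T b [tuple of a :: C] y =
    l * sym_wedge (G y) (h ^~ y) a b C) ->
  nabla2 T c a [tuple of b :: B] x + nabla2 T c b [tuple of a :: B] x =
  l * sym_wedge (G x) (fun C => nabla g h c C x) a b B.
Proof.
move=> sT sh Ux CKY; rewrite !nabla2_cons.
rewrite -(nabla3_swap (fun a b (C : k.-tuple 'I_n) => nabla g T a [tuple of b :: C])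
  c a b).
have dh C : pderivable (h C) x by exact: smooth_on_pderivable (sh C) Ux.
have dg C : pderivable (g C) x by exact: smooth_on_pderivable (sg C) Ux.
have dT a' C : pderivable (nabla g T a' C) x.
  exact: (pderivable_nabla oU sg gunit sT).
pose E1 a b (C : k.-tuple 'I_n) y :=
  nabla g T a [tuple of b :: C] y + nabla g T b [tuple of a :: C] y.
(* This is [sym_wedge] with a factor [-1] instead of a difference, the form covered by [nabla3D] and
   [nabla3_scale]. *)
pose W a b (C : k.-tuple 'I_n) y :=
  2 * (g [tuple a; b] y * h C y) + (-1) *
     \sum_(i < k) (g [tuple a; tnth C i] y * h (tsubst C i b) y
                  + g [tuple b; tnth C i] y * h (tsubst C i a) y).
have EW a' b' C y : U y -> E1 a' b' C y = l * W a' b' C y.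
  move=> Uy; apply: etrans (CKY y Uy a' b' C) _; congr (l * _).
  by rewrite /W mulN1r.
transitivity (nabla3 E1 c a b B x).
  symmetry; apply: (@nabla3D _
    (fun a b (C : k.-tuple 'I_n) => nabla g T a [tuple of b :: C])
    (fun a b (C : k.-tuple 'I_n) => nabla g T b [tuple of a :: C])) => *; exact: dT.
rewrite (nabla3_eq_on c a b B Ux EW).
have dgh C C' : pderivable (fun y => g C y * h C' y) x by exact: pderivableM.
have ds a' b' C : pderivable (fun y => 
     \sum_(i < k) (g [tuple a'; tnth C i] y * h (tsubst C i b') y
                  + g [tuple b'; tnth C i] y * h (tsubst C i a') y)) x.
  by apply: pderivable_sum => i _; exact: pderivableD.
have dgh' a' b' C : pderivable (fun y => 2 * (g [tuple a'; b'] y * h C y)) x.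
  by apply: pderivableM (dgh _ _); exact: pderivable_cst.
have ds' a' b' C : pderivable (fun y => (-1) *
     \sum_(i < k) (g [tuple a'; tnth C i] y * h (tsubst C i b') y
                  + g [tuple b'; tnth C i] y * h (tsubst C i a') y)) x.
  by apply: pderivableM (ds _ _ _); exact: pderivable_cst.
rewrite nabla3_scale; last first.
  by move=> a' b' C; exact: pderivableD (dgh' _ _ _) (ds' _ _ _).
congr (_ * _); rewrite /W nabla3D; [|exact: dgh'|exact: ds'].
rewrite (nabla3_scale (e := fun a b C y => g [tuple a; b] y * h C y)); last first.
  by move=> a' b' C; exact: dgh.
rewrite nabla3_metric //.
rewrite (nabla3_scale (e := fun a b C y =>
  \sum_(i < k) (g [tuple a; tnth C i] y * h (tsubst C i b) y
               + g [tuple b; tnth C i] y * h (tsubst C i a) y)) _ _ _ _ _ ds).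
rewrite mulN1r; congr (_ - _).
rewrite nabla3_sum => [|i a' b' C]; last exact: pderivableD.
apply: eq_bigr => i _; rewrite nabla3D.
- rewrite nabla3_metric_subst //; congr (_ + _).
  rewrite (nabla3_swap (fun a b C y => g [tuple a; tnth C i] y * h (tsubst C i b) y)).
  by rewrite nabla3_metric_subst.
- by move=> a' b' C; exact: dgh.
by move=> a' b' C; exact: dgh.
Qed.

End CovariantDerivative.

(** * Transposing two indices of a skew tensor *)

Section SkewSwap.
Context {R : realType} {n : nat}.

Lemma skew_swap k (T : k.-tuple 'I_n -> R) B i j a b : skew T -> i != j ->
  T (tsubst (tsubst B i a) j b) = - T (tsubst (tsubst B i b) j a).
Proof.
move=> skT ij; rewrite -[RHS]mulN1r -[X in X * _]expr1.
(* The exponent 1 is the parity of the transposition. *)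
have -> : 1%N = tperm i j by rewrite odd_tperm ij.
rewrite -skT; congr T; apply: eq_from_tnth => l.
rewrite tnth_tperm_idx !tnth_tsubst.
case: tpermP => [->|->|/eqP li /eqP lj].
- by rewrite ?eqxx ?(negbTE ij).
- by rewrite ?eqxx ?(negbTE ij) // eqxx.
by rewrite (negbTE li) (negbTE lj).
Qed.

Context {k : nat} (T : k.+2.-tuple 'I_n -> R).
Hypothesis skT : skew T.
Implicit Types (E : k.-tuple 'I_n).

Lemma skew_swap01 a b E :
  T [tuple of a :: [tuple of b :: E]] = - T [tuple of b :: [tuple of a :: E]].
Proof.
have := @skew_swap _ T [tuple of a :: [tuple of b :: E]] ord0
  (lift ord0 ord0) a b skT isT.
by rewrite !tsubst_cons0 !tsubst_consS !tsubst_cons0.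
Qed.

Lemma skew_swap0 a b E j f :
  T [tuple of a :: [tuple of b :: tsubst E j f]] =
  - T [tuple of f :: [tuple of b :: tsubst E j a]].
Proof.
have := @skew_swap _ T [tuple of a :: [tuple of b :: E]] ord0
  (lift ord0 (lift ord0 j)) a f skT isT.
by rewrite !tsubst_cons0 !tsubst_consS.
Qed.

Lemma skew_swap1 d a E j f :
  T [tuple of d :: [tuple of a :: tsubst E j f]] =
  - T [tuple of d :: [tuple of f :: tsubst E j a]].
Proof. by rewrite skew_swap01 skew_swap0 -skew_swap01. Qed.

End SkewSwap.

(** * Contractions at a point *)

Section Contraction.
Context {R : realType} {n : nat} (G I : 'I_n -> 'I_n -> R).
Hypothesis GC : forall a b, G a b = G b a.
Hypothesis IC : forall a b, I a b = I b a.
Hypothesis IG : forall a b, \sum_c I a c * G c b = (a == b)%:R.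
Implicit Types (a b c d e f : 'I_n) (A y : 'I_n -> 'I_n -> R).

(** [G] and [I] stand for the metric and its inverse at a point, so this is $g^{ab}A_{ab}$. *)
Definition tr A : R := \sum_a \sum_b I a b * A a b.

Lemma eq_tr A A' : A =2 A' -> tr A = tr A'.
Proof. by move=> E; apply: eq_bigr => a _; apply: eq_bigr => b _; rewrite E. Qed.

Lemma trD A A' : tr (fun a b => A a b + A' a b) = tr A + tr A'.
Proof.
rewrite -big_split; apply: eq_bigr => a _; rewrite -big_split.
by apply: eq_bigr => b _; rewrite mulrDr.
Qed.

Lemma trZ l A : tr (fun a b => l * A a b) = l * tr A.
Proof.
rewrite mulr_sumr; apply: eq_bigr => a _; rewrite mulr_sumr.
by apply: eq_bigr => b _; rewrite mulrCA.
Qed.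

Lemma trN A : tr (fun a b => - A a b) = - tr A.
Proof.
by rewrite -mulN1r -trZ; apply: eq_tr => a b; rewrite mulN1r.
Qed.

Lemma trB A A' : tr (fun a b => A a b - A' a b) = tr A - tr A'.
Proof. by rewrite trD trN. Qed.

Lemma tr0 : tr (fun _ _ => 0) = 0.
Proof. by apply: big1 => a _; apply: big1 => b _; rewrite mulr0. Qed.

Lemma tr_sum J (r : seq J) (P : pred J) (A : J -> 'I_n -> 'I_n -> R) :
  tr (fun a b => \sum_(j <- r | P j) A j a b) = \sum_(j <- r | P j) tr (A j).
Proof.
rewrite [RHS]exchange_big; apply: eq_bigr => a _.
rewrite [RHS]exchange_big; apply: eq_bigr => b _.
by rewrite mulr_sumr.
Qed.

Lemma tr_flip A : tr A = tr (fun a b => A b a).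
Proof.
rewrite /tr exchange_big; apply: eq_bigr => a _; apply: eq_bigr => b _.
by rewrite IC.
Qed.

Lemma tr_skew A : (forall a b, A a b = - A b a) -> tr A = 0.
Proof.
move=> skA; have : tr A = - tr A by rewrite {1}tr_flip -trN; apply: eq_tr.
by move=> ?; lra.
Qed.

Lemma tr_exchange (A : 'I_n -> 'I_n -> 'I_n -> 'I_n -> R) :
  tr (fun a b => tr (A a b)) = tr (fun c d => tr (fun a b => A a b c d)).
Proof.
rewrite /tr; under eq_bigr do under eq_bigr do rewrite mulr_sumr.
under eq_bigr do rewrite exchange_big; rewrite exchange_big.
apply: eq_bigr => c _.
under eq_bigr do under eq_bigr do rewrite mulr_sumr.
under eq_bigr do rewrite exchange_big; rewrite exchange_big.
apply: eq_bigr => d _; rewrite mulr_sumr; apply: eq_bigr => a _.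
by rewrite mulr_sumr; apply: eq_bigr => b _; rewrite mulrCA.
Qed.

Lemma tr_metric : tr G = n%:R.
Proof.
rewrite /tr; under eq_bigr do under eq_bigr do rewrite GC.
under eq_bigr do rewrite IG eqxx.
by rewrite sumr_const card_ord.
Qed.

Lemma tr_metric_l c (F : 'I_n -> R) : tr (fun a b => G c a * F b) = F c.
Proof.
rewrite tr_flip /tr; transitivity (\sum_a (a == c)%:R * F a).
  apply: eq_bigr => a _; rewrite -IG mulr_suml; apply: eq_bigr => b _.
  by rewrite (GC c) mulrA.
rewrite (bigD1 c)//= eqxx mul1r big1 ?addr0// => a /negbTE ->.
by rewrite mul0r.
Qed.

Lemma tr_metric_r c (F : 'I_n -> R) : tr (fun a b => G c b * F a) = F c.
Proof. by rewrite tr_flip tr_metric_l. Qed.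

(** The trace of [G] gives [2 * n]; each slot of [B] takes away 2, since contracting with [G] puts
    the replaced entry back. *)
Lemma tr_sym_wedge k (h : k.-tuple 'I_n -> R) B :
  tr (fun a b => sym_wedge G h a b B) = 2 * (n%:R - k%:R) * h B.
Proof.
rewrite trB trZ tr_sum.
under [X in 2 * X]eq_tr do rewrite mulrC.
rewrite trZ tr_metric; under eq_bigr => i _.
  rewrite trD.
  under eq_tr do rewrite GC.
  rewrite (tr_flip (fun a b => G b _ * _)).
  under [X in _ + X]eq_tr do rewrite GC.
  rewrite tr_metric_l tsubst_id; over.
by rewrite sumr_const card_ord; ring.
Qed.

(** The full contraction $A^{bd}y_{bd}$. *)
Definition pairing A y : R := tr (fun a b => tr (fun c d => A a c * y b d)).

(** This is the order of summation in [weyl_contr], which raises indices before contracting. *)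
Lemma pairingE A y : pairing A y =
  \sum_b \sum_d (\sum_a \sum_c I b a * I d c * A a c) * y b d.
Proof.
rewrite /pairing tr_flip; apply: eq_bigr => b _.
under eq_bigr do rewrite tr_flip /tr mulr_sumr.
rewrite exchange_big; apply: eq_bigr => d _; rewrite mulr_suml.
apply: eq_bigr => a _; rewrite mulr_sumr mulr_suml; apply: eq_bigr => c _.
by rewrite !mulrA.
Qed.

Lemma eq_pairing A A' y y' : A =2 A' -> y =2 y' -> pairing A y = pairing A' y'.
Proof.
by move=> eA ey; apply: eq_tr => a b; apply: eq_tr => c d; rewrite eA ey.
Qed.

Lemma pairingDl A A' y :
  pairing (fun a b => A a b + A' a b) y = pairing A y + pairing A' y.
Proof.
rewrite -trD; apply: eq_tr => a b; rewrite -trD.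
by apply: eq_tr => c d; rewrite mulrDl.
Qed.

Lemma pairingZl l A y :
  pairing (fun a b => l * A a b) y = l * pairing A y.
Proof.
rewrite -trZ; apply: eq_tr => a b; rewrite -trZ.
by apply: eq_tr => c d; rewrite mulrA.
Qed.

Lemma pairingNl A y : pairing (fun a b => - A a b) y = - pairing A y.
Proof.
by rewrite -mulN1r -pairingZl; apply: eq_pairing => // a b; rewrite mulN1r.
Qed.

Lemma pairingBl A A' y :
  pairing (fun a b => A a b - A' a b) y = pairing A y - pairing A' y.
Proof. by rewrite pairingDl pairingNl. Qed.

Lemma pairingNr A y : pairing A (fun a b => - y a b) = - pairing A y.
Proof.
rewrite -trN; apply: eq_tr => a b; rewrite -trN.
by apply: eq_tr => c d; rewrite mulrN.
Qed.

Lemma pairing_skew A y : (forall a b, y a b = - y b a) ->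
  pairing (fun a b => A b a) y = - pairing A y.
Proof.
move=> sky; rewrite -pairingNr /pairing tr_exchange.
by apply: eq_tr => a b; apply: eq_tr => c d; rewrite (sky d).
Qed.

Lemma pairing_metric e c y : pairing (fun a b => G a e * G b c) y = y e c.
Proof.
rewrite /pairing -[RHS](tr_metric_l e (fun b => y b c)); apply: eq_tr => a b.
rewrite -(tr_metric_l c (y b)) -trZ; apply: eq_tr => u v.
by rewrite (GC a) (GC u) mulrA.
Qed.

End Contraction.

(** * The Killing-Yano defect of $h$ at one point, as linear algebra *)

Section PointwiseCKY.
Context {R : realType} {n k : nat} (G I : 'I_n -> 'I_n -> R).
Hypothesis GC : forall a b, G a b = G b a.
Hypothesis IC : forall a b, I a b = I b a.
Hypothesis IG : forall a b, \sum_c I a c * G c b = (a == b)%:R.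
Variables (Rup Rm : 'I_n -> 'I_n -> 'I_n -> 'I_n -> R) (Lambda : R).
Hypothesis RupE : forall a b d e, Rup a b d e = \sum_c I e c * Rm a b c d.
Hypothesis RmC12 : forall a b c d, Rm a b c d = - Rm b a c d.
Hypothesis RmC34 : forall a b c d, Rm a b c d = - Rm a b d c.
Hypothesis Rm_pair : forall a b c d, Rm a b c d = Rm c d a b.
Hypothesis Rm_bianchi :
  forall a b c d, Rm a b c d + Rm b c a d + Rm c a b d = 0.
Hypothesis einstein :
  forall a b, \sum_c \sum_d I c d * Rm c a d b = Lambda * G a b.

Local Notation tr := (tr I).
Local Notation pairing := (pairing I).

Lemma tr_riemann_mid a b : tr (fun c d => Rm a c d b) = - (Lambda * G a b).
Proof.
by rewrite -einstein -trN; apply: eq_tr => c d; rewrite RmC12.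
Qed.

Lemma tr_riemann_outer a b : tr (fun c d => Rm a c b d) = Lambda * G a b.
Proof.
rewrite -[RHS]opprK -tr_riemann_mid -trN; apply: eq_tr => c d.
by rewrite RmC34.
Qed.

Lemma contract_Rup a b c (F : 'I_n -> R) :
  \sum_f Rup a b c f * F f = tr (fun d f => Rm a b d c * F f).
Proof.
rewrite tr_flip //; apply: eq_bigr => f _; rewrite RupE mulr_suml.
by apply: eq_bigr => d _; rewrite mulrA.
Qed.

(** Renaming the three contracted pairs cyclically leaves [y] unchanged and gives three forms of the
    same trace, whose sum is 0 by the Bianchi identity. *)
Lemma bianchi_contract e (y : 'I_n -> 'I_n -> 'I_n -> R) :
  (forall a b c, y a b c = y b c a) ->
  tr (fun c d => tr (fun a b => tr (fun f f' => Rm c a f e * y d b f'))) = 0.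
Proof.
move=> ycyc; set X := tr _.
have cyc (F : 'I_n -> 'I_n -> 'I_n -> 'I_n -> 'I_n -> 'I_n -> R) :
  tr (fun c d => tr (fun a b => tr (F c d a b))) =
  tr (fun c d => tr (fun a b => tr (fun f f' => F f f' c d a b))).
  by under [RHS]eq_tr do rewrite tr_exchange; rewrite [RHS]tr_exchange.
have X1 : X = tr (fun c d => tr (fun a b => tr (fun f f' =>
    Rm f c a e * y d b f'))).
  rewrite /X (cyc (fun c d a b f f' => Rm c a f e * y d b f')).
  apply: eq_tr => c d; apply: eq_tr => a b; apply: eq_tr => f f'.
  by rewrite ycyc.
have X2 : X = tr (fun c d => tr (fun a b => tr (fun f f' =>
    Rm a f c e * y d b f'))).
  rewrite X1 (cyc (fun c d a b f f' => Rm f c a e * y d b f')).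
  apply: eq_tr => c d; apply: eq_tr => a b; apply: eq_tr => f f'.
  by rewrite ycyc.
have : X + X + X = 0.
  rewrite {2}X1 [X in _ + X]X2 /X -trD -trD; apply: etrans (tr0 I).
  apply: eq_tr => c d; rewrite -!trD; apply: etrans (tr0 I).
  apply: eq_tr => a b; rewrite -!trD; apply: etrans (tr0 I).
  apply: eq_tr => f f'; rewrite -!mulrDl.
  by rewrite addrAC Rm_bianchi mul0r.
by lra.
Qed.

(** Only the part of [Rm c b f e] skew in [b], [f] meets the skew [y]; by the Bianchi identity and
    pair symmetry it is half of [Rm b f e c]. *)
Lemma curvature_pairing c e (y : 'I_n -> 'I_n -> R) :
  (forall a b, y a b = - y b a) ->
  pairing (fun b f => Rm c b f e) y = 2^-1 * pairing (fun b f => Rm b f e c) y.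
Proof.
move=> sky; have E := pairing_skew I (fun b f => Rm c b f e) sky.
have -> : pairing (fun b f => Rm b f e c) y =
  pairing (fun b f => Rm c b f e - Rm c f b e) y.
  apply: eq_pairing => // b f; have := Rm_bianchi f e b c.
  rewrite (Rm_pair c b f e) (Rm_pair c f b e) (RmC34 f e c b) (RmC34 b e c f).
  rewrite (RmC12 b e) => ?; lra.
by rewrite pairingBl E; lra.
Qed.

(** [H c B] stands for $\nabla_c h_B$ and [D c a B] for $\nabla_c\nabla_a Y_B$. *)
Variables (Y : k.+2.-tuple 'I_n -> R) (H : 'I_n -> k.+1.-tuple 'I_n -> R).
Variable D : 'I_n -> 'I_n -> k.+2.-tuple 'I_n -> R.
Variable l : R.
Hypothesis skY : skew Y.
Hypothesis skD : forall c a, skew (D c a).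
Hypothesis cky : forall c a b (B : k.+1.-tuple 'I_n),
  D c a [tuple of b :: B] + D c b [tuple of a :: B] =
  l * sym_wedge G (H c) a b B.
Hypothesis ricciD : forall a b B, D a b B - D b a B =
  - \sum_(i < k.+2) \sum_f Rup a b (tnth B i) f * Y (tsubst B i f).
Hypothesis l0 : l != 0.
Hypothesis nk : n%:R - k.+1%:R != 0 :> R.

Lemma ricciD2 a b c d (E : k.-tuple 'I_n) :
  D a b [tuple of c :: [tuple of d :: E]] - D b a [tuple of c :: [tuple of d :: E]] =
  - (tr (fun f' f => Rm a b f' c * Y [tuple of f :: [tuple of d :: E]]) +
     (tr (fun f' f => Rm a b f' d * Y [tuple of c :: [tuple of f :: E]]) +
     \sum_(j < k) tr (fun f' f => Rm a b f' (tnth E j) *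
                       Y [tuple of c :: [tuple of d :: tsubst E j f]]))).
Proof.
rewrite ricciD !big_ord_recl !contract_Rup !tnth_lift0; congr (- (_ + (_ + _))).
- by apply: eq_tr => f' f; rewrite tsubst_cons0.
- by apply: eq_tr => f' f; rewrite tsubst_consS tsubst_cons0.
apply: eq_bigr => j _; rewrite contract_Rup !tnth_lift0.
by apply: eq_tr => f' f; rewrite !tsubst_consS.
Qed.

(** The two terms of the equation have equal traces as [I] is symmetric, so a factor 2 cancels
    against that of [tr_sym_wedge]. *)
Lemma tr_CKY c (B : k.+1.-tuple 'I_n) :
  tr (fun a b => D c a [tuple of b :: B]) = l * (n%:R - k.+1%:R) * H c B.
Proof.
have : tr (fun a b => D c a [tuple of b :: B] + D c b [tuple of a :: B]) =
    l * (2 * (n%:R - k.+1%:R) * H c B).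
  by rewrite -(tr_sym_wedge GC IC IG) -trZ; apply: eq_tr => a b; exact: cky.
by rewrite trD [X in _ + X]tr_flip // => ?; lra.
Qed.

(* h is a multiple of the divergence of the skew Y, and the double divergence
   of Y is a curvature term killed by the Bianchi identity. *)
Lemma divergence_free (E : k.-tuple 'I_n) :
  tr (fun c d => H c [tuple of d :: E]) = 0.
Proof.
pose Q (c d a b : 'I_n) := D c a [tuple of b :: [tuple of d :: E]].
have lH : l * (n%:R - k.+1%:R) * tr (fun c d => H c [tuple of d :: E]) =
  tr (fun c d => tr (Q c d)).
  by rewrite -trZ; apply: eq_tr => c d; rewrite -tr_CKY.
(* Skewness turns the exchange of the two traces into an exchange of the derivatives, so twice the
   double divergence is a commutator. *)
have Qflip : tr (fun c d => tr (Q c d)) = - tr (fun c d => tr (fun a b =>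
    D a c [tuple of b :: [tuple of d :: E]])).
  rewrite tr_exchange -trN; apply: eq_tr => a b; rewrite -trN.
  by apply: eq_tr => c d; rewrite /Q skew_swap01.
suff Q0 : tr (fun c d => tr (Q c d)) + tr (fun c d => tr (Q c d)) = 0.
  apply: (mulfI (mulf_neq0 l0 nk)); rewrite lH mulr0; lra.
rewrite {2}Qflip -trB.
transitivity (- (
  tr (fun c d => tr (fun a b => tr (fun f' f =>
     Rm c a f' b * Y [tuple of f :: [tuple of d :: E]]))) +
  (tr (fun c d => tr (fun a b => tr (fun f' f =>
     Rm c a f' d * Y [tuple of b :: [tuple of f :: E]]))) +
  \sum_(j < k) tr (fun c d => tr (fun a b => tr (fun f' f =>
     Rm c a f' (tnth E j) * Y [tuple of b :: [tuple of d :: tsubst E j f]])))))).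
  rewrite -tr_sum -!trD -trN; apply: eq_tr => c d.
  rewrite -trB -tr_sum -!trD -trN; apply: eq_tr => a b.
  exact: ricciD2.
apply/eqP; rewrite oppr_eq0; apply/eqP.
(* On the first slot the curvature contracts to the Ricci tensor, hence to a multiple of a trace of
   the skew [Y]; the second slot is treated alike below. *)
rewrite [X in X + _](_ : _ = 0); last first.
  transitivity (tr (fun c d => Lambda * Y [tuple of c :: [tuple of d :: E]])).
    apply: eq_tr => c d; rewrite tr_exchange.
    rewrite -(tr_metric_l GC IC IG c (fun f => Y [tuple of f :: [tuple of d :: E]])).
    rewrite -trZ; apply: eq_tr => f' f.
    rewrite mulrA -tr_riemann_outer.
    rewrite mulrC -trZ; apply: eq_tr => a b.
    by rewrite mulrC.
  rewrite trZ tr_skew ?mulr0// => c d; exact: skew_swap01.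
rewrite add0r [X in X + _](_ : _ = 0); last first.
  rewrite tr_exchange.
  transitivity (tr (fun a b => - Lambda * Y [tuple of b :: [tuple of a :: E]])).
    apply: eq_tr => a b; rewrite tr_exchange.
    rewrite -(tr_metric_l GC IC IG a (fun f => Y [tuple of b :: [tuple of f :: E]])).
    rewrite -trZ; apply: eq_tr => f' f.
    rewrite mulrA mulNr -tr_riemann_mid mulrC -trZ; apply: eq_tr => c d.
    by rewrite mulrC RmC12 RmC34 opprK.
  rewrite trZ tr_skew ?mulr0// => c d; exact: skew_swap01.
rewrite add0r; apply: big1 => j _.
apply: bianchi_contract (fun d b f => Y [tuple of b :: [tuple of d :: tsubst E j f]]) _.
by move=> a b c; rewrite skew_swap01 // skew_swap0 // opprK.
Qed.

(** The contraction of the theorem, before symmetrization, with the Riemann tensor in place of the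
    Weyl tensor. *)
Let sum_slots c d (E : k.-tuple 'I_n) :=
  \sum_(j < k) pairing (fun a f => Rm a f (tnth E j) c)
    (fun a f => Y [tuple of d :: [tuple of a :: tsubst E j f]]).

(** Moving [d] in front of [a] makes the equation apply to the pair [c], [d]. In the traced wedge
    the divergences of [h] vanish, and only the terms with [G c a] and [G d a] survive. *)
Lemma tr_CKY_swapped c d (E : k.-tuple 'I_n) :
  tr (fun b a => D b c [tuple of a :: [tuple of d :: E]]) +
  tr (fun b a => D b d [tuple of a :: [tuple of c :: E]]) =
  l * (H c [tuple of d :: E] + H d [tuple of c :: E]).
Proof.
transitivity (- (l * tr (fun b a => sym_wedge G (H b) c d [tuple of a :: E]))).
  rewrite -trD -trZ -trN; apply: eq_tr => b a.
  by rewrite -cky skew_swap01 // (skew_swap01 (skD b d)) opprD.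
rewrite -mulrN; congr (_ * _).
transitivity (- (2 * (G c d * tr (fun b a => H b [tuple of a :: E])) -
  (tr (fun b a => G c a * H b [tuple of d :: E]) +
   tr (fun b a => G d a * H b [tuple of c :: E]) +
   \sum_(j < k)
     (G c (tnth E j) * tr (fun b a => H b [tuple of a :: tsubst E j d]) +
      G d (tnth E j) * tr (fun b a => H b [tuple of a :: tsubst E j c]))))).
  congr (- _); under [in RHS]eq_bigr do rewrite -!trZ -trD.
  rewrite -tr_sum -!trD -!trZ -trB; apply: eq_tr => b a.
  rewrite /sym_wedge big_ord_recl; congr (_ - (_ + _)).
    by rewrite !tsubst_cons0.
  by apply: eq_bigr => j _; rewrite tnth_lift0 !tsubst_consS.
rewrite !divergence_free !mulr0 !(tr_metric_r GC IC IG) big1 => [|j _].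
  by ring.
by rewrite !divergence_free !mulr0 addr0.
Qed.

(** In the Ricci identity the slot of [a] yields the Ricci tensor, the slot of [d] the last pairing,
    and the slots of [E] reduce by [curvature_pairing]. *)
Lemma tr_commutator c d (E : k.-tuple 'I_n) :
  tr (fun b a => D c b [tuple of a :: [tuple of d :: E]]) -
  tr (fun b a => D b c [tuple of a :: [tuple of d :: E]]) =
  2^-1 * sum_slots c d E - Lambda * Y [tuple of c :: [tuple of d :: E]]
  - pairing (fun b f => Rm c b f d) (fun a f => Y [tuple of a :: [tuple of f :: E]]).
Proof.
transitivity (- (
  tr (fun b a => tr (fun f' f =>
     Rm c b f' a * Y [tuple of f :: [tuple of d :: E]])) +
  (pairing (fun b f => Rm c b f d) (fun a f => Y [tuple of a :: [tuple of f :: E]]) +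
  \sum_(j < k) pairing (fun b f => Rm c b f (tnth E j))
     (fun a f => Y [tuple of a :: [tuple of d :: tsubst E j f]])))).
  rewrite -trB -tr_sum -!trD -trN; apply: eq_tr => b a; exact: ricciD2.
have -> : tr (fun b a => tr (fun f' f =>
     Rm c b f' a * Y [tuple of f :: [tuple of d :: E]])) =
   Lambda * Y [tuple of c :: [tuple of d :: E]].
  rewrite tr_exchange.
  rewrite -(tr_metric_l GC IC IG c (fun f => Y [tuple of f :: [tuple of d :: E]])).
  rewrite -trZ; apply: eq_tr => f' f.
  rewrite mulrA -tr_riemann_outer mulrC -trZ; apply: eq_tr => b a.
  by rewrite mulrC.
have -> : \sum_(j < k) pairing (fun b f => Rm c b f (tnth E j))
     (fun a f => Y [tuple of a :: [tuple of d :: tsubst E j f]]) =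
   - (2^-1 * sum_slots c d E).
  rewrite mulr_sumr -sumrN; apply: eq_bigr => j _.
  rewrite -curvature_pairing => [|a f]; last exact: skew_swap1.
  rewrite -pairingNr; apply: eq_pairing => // a f; exact: skew_swap01.
by ring.
Qed.

(** The symmetrized [H] occurs with coefficient [n - k.+1] in one order of the derivatives and 1 in
    the other, whence [n - k.+2]. The [Lambda] terms cancel by skewness of [Y]. *)
Lemma killing_defect c d (E : k.-tuple 'I_n) :
  l * (n%:R - k.+2%:R) * (H c [tuple of d :: E] + H d [tuple of c :: E]) =
  2^-1 * (sum_slots c d E + sum_slots d c E).
Proof.
have X1 := tr_CKY c [tuple of d :: E].
have X2 := tr_CKY d [tuple of c :: E].
have Z := tr_CKY_swapped c d E.
have C1 := tr_commutator c d E; have C2 := tr_commutator d c E.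
(* By pair symmetry the summed curvature is symmetric in [b], [f], and it is paired with a skew
   tensor. *)
have S : pairing (fun b f => Rm c b f d) (fun a f => Y [tuple of a :: [tuple of f :: E]]) +
  pairing (fun b f => Rm d b f c) (fun a f => Y [tuple of a :: [tuple of f :: E]]) = 0.
  rewrite -pairingDl.
  have := @pairing_skew _ _ I (fun b f => Rm c b f d + Rm d b f c)
     (fun a f => Y [tuple of a :: [tuple of f :: E]]) (fun a b => skew_swap01 skY a b E).
  set P := pairing _ _; set P' := pairing _ _; suff -> : P = P' by move=> ?; lra.
  apply: eq_pairing => // b f.
  by rewrite [LHS]addrC; congr (_ + _); rewrite Rm_pair RmC12 RmC34 opprK.
have Yc := skew_swap01 skY c d E.
rewrite X1 in C1; rewrite X2 in C2.
move: Z C1 C2 S Yc; rewrite -!natr1.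
move: (tr _) (tr _) (pairing _ _) (pairing _ _) => t1 t2 p1 p2.
move: (sum_slots _ _ _) (sum_slots _ _ _) (H _ _) (H _ _) (Y _) (Y _).
move=> s1 s2 h1 h2 y1 y2 Z C1 C2 S Yc.
nra.
Qed.

End PointwiseCKY.

(** * From the patch to the manifold *)

Section MetricWedge.
Context {R : realType} {n : nat}.

(* Permutations are parametrized by i = s 0 and a permutation of the remaining
   slots; for skew h the antisymmetrized term depends on i only. *)
Definition lift0_tperm k (p : 'I_k.+1 * 'S_k) : 'S_k.+1 :=
  (lift_perm ord0 ord0 p.2 * tperm ord0 p.1)%g.

Lemma lift0_tperm0 k (p : 'I_k.+1 * 'S_k) : lift0_tperm p ord0 = p.1.
Proof. by rewrite permM lift_perm_id tpermL. Qed.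

Lemma lift0_tperm_bij k : bijective (@lift0_tperm k).
Proof.
apply: inj_card_bij => [[i u] [j v] E|].
  have ij : i = j.
    by have := congr1 (fun s : 'S_k.+1 => s ord0) E; rewrite !lift0_tperm0.
  move: E; rewrite ij => /mulIg E; congr pair; apply/permP => l.
  have := congr1 (fun s : 'S_k.+1 => s (lift ord0 l)) E.
  by rewrite !lift_perm_lift => /lift_inj.
by rewrite card_prod card_ord !card_Sn factS.
Qed.

(** The sum over permutations collapses to one term for each index placed next to [a], each
    occurring [k!] times; against [(k+1)!] this leaves the factor in front. *)
Lemma metric_wedgeE (g : comps R n 2) k (h : comps R n k) a b
    (B : k.-tuple 'I_n) x : skew (h ^~ x) ->
  metric_wedge g h a [tuple of b :: B] x =
  k.+1%:R^-1 * (g [tuple a; b] x * h B x -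
    \sum_(i < k) g [tuple a; tnth B i] x * h (tsubst B i b) x).
Proof.
move=> skh; rewrite /metric_wedge /antisym.
rewrite (reindex _ (onW_bij _ (@lift0_tperm_bij k))) /=.
pose F (i : 'I_k.+1) : R :=
  if unlift ord0 i is Some j then - (g [tuple a; tnth B j] x * h (tsubst B j b) x)
  else g [tuple a; b] x * h B x.
transitivity (k.+1`!%:R^-1 * \sum_(p : 'I_k.+1 * 'S_k) F p.1).
  congr (_ * _); apply: eq_bigr => -[i u] _.
  (* The indices left for [h]: when the metric takes an entry of [B], the index [b] fills its
     slot. *)
  pose B' : k.-tuple 'I_n := if unlift ord0 i is Some j then tsubst B j b else B.
  have -> : thead (tperm_idx [tuple of b :: B] (lift0_tperm (i, u))) =
      tnth [tuple of b :: B] i.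
    by rewrite /thead tnth_tperm_idx lift0_tperm0.
  have -> : [tuple of behead (tperm_idx [tuple of b :: B] (lift0_tperm (i, u)))] =
      tperm_idx B' u.
    apply: eq_from_tnth => l; rewrite tnth_behead !tnth_tperm_idx.
    rewrite (_ : inord l.+1 = lift ord0 l); last first.
      by apply: val_inj; rewrite /= inordK // ltnS.
    rewrite permM lift_perm_lift /B' /=.
    case: unliftP => [j ->|->]; last by rewrite tperm1 perm1 tnth_lift0.
    rewrite tnth_tsubst; case: (eqVneq (u l) j) => [->|lj]; first by rewrite tpermR.
    have -> : tperm ord0 (lift ord0 j) (lift ord0 (u l)) = lift ord0 (u l).
      by apply: tpermD; rewrite // (inj_eq lift_inj) eq_sym.
    exact: tnth_lift0.
  (* The sign of [u] comes both from the antisymmetrization and from [h], so only the sign of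
     [tperm ord0 i] is left. *)
  rewrite skh odd_permM odd_lift_perm odd_tperm addFb signr_addb /F /B' /=.
  have sq : (-1) ^+ u * (-1) ^+ u = 1 :> R by rewrite -expr2 sqrr_sign.
  have alg (e s v w : R) : e * e = 1 -> e * s * (v * (e * w)) = s * (v * w).
    by move=> ee; rewrite -[in RHS](mul1r w) -ee; ring.
  case: unliftP => [j ->|->]; rewrite ?tnth_lift0 /= alg //.
    by rewrite expr1 mulN1r.
  by rewrite expr0 mul1r.
rewrite -(pair_bigA _ (fun i _ => F i)) /=.
under eq_bigr do rewrite sumr_const card_Sn -mulr_natr.
rewrite -mulr_suml factS natrM invfM.
rewrite big_ord_recl /F unlift_none.
have f0 : k`!%:R != 0 :> R by rewrite pnatr_eq0 -lt0n fact_gt0.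
rewrite -[LHS]mulrA [X in _ * X]mulrCA mulVf // mulr1; congr (_ * (_ + _)).
by rewrite -sumrN; apply: eq_bigr => i _; rewrite liftK.
Qed.

End MetricWedge.

(** * The defect formula in one chart *)

Section ChartCKY.
Context {R : realType} {n k : nat} (U : set 'rV[R]_n) (g : comps R n 2).
Variables (Lambda : R) (Y : comps R n k.+2) (h : comps R n k.+1).
Hypothesis oU : open U.
Hypothesis sg : forall B, smooth_on U (g B).
Hypothesis gC : forall x, U x -> forall a b, g [tuple a; b] x = g [tuple b; a] x.
Hypothesis gunit : forall x, U x -> gmx g x \in unitmx.
Hypothesis einstein : forall x, U x -> forall a b,
  ricci g a b x = Lambda * g [tuple a; b] x.
Hypothesis sY : forall B, smooth_on U (Y B).
Hypothesis sh : forall B, smooth_on U (h B).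
Hypothesis skY : forall x, U x -> skew (Y ^~ x).
Hypothesis skh : forall x, U x -> skew (h ^~ x).
Hypothesis kn : (k.+2 < n)%N.
Hypothesis cky : forall x, U x -> forall a b (B : k.+1.-tuple 'I_n),
  nabla g Y a [tuple of b :: B] x + nabla g Y b [tuple of a :: B] x =
  2 * metric_wedge g h a [tuple of b :: B] x +
  2 * metric_wedge g h b [tuple of a :: B] x.

(** The factor 2 of the equation over the weight $p$ of the normalized antisymmetrization. *)
Let l : R := 2 / k.+2%:R.

Lemma CKY_sym_wedge x : U x -> forall a b (B : k.+1.-tuple 'I_n),
  nabla g Y a [tuple of b :: B] x + nabla g Y b [tuple of a :: B] x =
  l * sym_wedge (fun a b => g [tuple a; b] x) (h ^~ x) a b B.
Proof.
move=> Ux a b B; rewrite cky // !metric_wedgeE; [|exact: skh|exact: skh].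
rewrite (gC Ux b a) /sym_wedge big_split /= /l.
by move: (\sum_(i < _) _) (\sum_(i < _) _) (g _ _) (h _ _) => *; ring.
Qed.

Let G x a b := g [tuple a; b] x.
Let I x a b := ginv g a b x.

Let GC x : U x -> forall a b, G x a b = G x b a.
Proof. by move=> Ux a b; exact: gC. Qed.

Let IC x : U x -> forall a b, I x a b = I x b a.
Proof. by move=> Ux a b; exact: (ginvC gC). Qed.

Let IG x : U x -> forall a b, \sum_c I x a c * G x c b = (a == b)%:R.
Proof. by move=> Ux a b; exact: (ginvM gunit). Qed.

Lemma divergence_CKY x (B : k.+1.-tuple 'I_n) : U x ->
  divergence g Y B x = l * (n%:R - k.+1%:R) * h B x.
Proof.
move=> Ux.
have -> : divergence g Y B x =
    tr (I x) (fun a b => nabla g Y b [tuple of a :: B] x) by [].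
have := tr_sym_wedge (GC Ux) (IC Ux) (IG Ux) (h ^~ x) B.
move/(congr1 ( *%R l)); rewrite -trZ.
rewrite (eq_tr (I x) (fun a b => esym (CKY_sym_wedge Ux a b B))) trD.
rewrite [X in X + _](tr_flip (IC Ux)).
by move: (tr _ _) => t; lra.
Qed.

(** The constant is inverse to the one in [divergence_CKY], which is nonzero because [k.+2 < n]. *)
Lemma CKY_h_eq x (B : k.+1.-tuple 'I_n) : U x ->
  k.+2%:R / (2 * (n%:R + 1 - k.+2%:R)) * divergence g Y B x = h B x.
Proof.
move=> Ux; rewrite divergence_CKY // /l.
have n0 : n%:R - k.+1%:R != 0 :> R.
  by rewrite -natrB ?pnatr_eq0 -?lt0n ?subn_gt0 ?(ltnW kn) // ltnW // ltnW.
have k0 : k.+2%:R != 0 :> R by rewrite pnatr_eq0.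
have -> : n%:R + 1 - k.+2%:R = n%:R - k.+1%:R :> R by rewrite -(natr1 k.+1); ring.
move: (_ - _) n0 (k.+2%:R) k0 => u u0 v v0.
by field; rewrite u0 v0.
Qed.

(** With Ricci proportional to the metric, the Ricci and scalar corrections are multiples of one
    constant curvature tensor; [kappa] collects the coefficients. *)
Lemma weyl_einstein x : U x -> exists kappa : R, forall a b c d,
  weyl g a b c d x = riemann g a b c d x +
  kappa * (g [tuple a; c] x * g [tuple b; d] x
           - g [tuple a; d] x * g [tuple b; c] x).
Proof.
move=> Ux; exists (scalar_curvature g x / ((n%:R - 1) * (n%:R - 2))
  - (n%:R - 2)^-1 * (2 * Lambda)) => a b c d.
rewrite /weyl !einstein // (gC Ux d b) (gC Ux c b) (gC Ux d a) (gC Ux c a).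
move: (riemann _ _ _ _ _ _) (scalar_curvature _ _ / _) (_^-1) => r s t.
ring.
Qed.

(** In each of the [k] slots the [kappa] term gives two entries of [Y] that add up by skewness.
    Their total is skew in [c], [d] and will drop out of the symmetrization. *)
Lemma weyl_contrE x kappa c d (E : k.-tuple 'I_n) : U x ->
  (forall a b c d, weyl g a b c d x = riemann g a b c d x +
    kappa * (g [tuple a; c] x * g [tuple b; d] x
             - g [tuple a; d] x * g [tuple b; c] x)) ->
  weyl_contr g Y c d E x =
  \sum_(j < k) pairing (I x) (fun a f => riemann g a f (tnth E j) c x)
    (fun a f => Y [tuple of d :: [tuple of a :: tsubst E j f]] x)
  - 2 * kappa * k%:R * Y [tuple of d :: [tuple of c :: E]] x.
Proof.
move=> Ux W.
transitivity (\sum_(j < k) pairing (I x) (fun a f => weyl g a f (tnth E j) c x)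
    (fun a f => Y [tuple of d :: [tuple of a :: tsubst E j f]] x)).
  apply: eq_bigr => j _; rewrite (pairingE (IC Ux)).
  apply: eq_bigr => a _; apply: eq_bigr => f _; congr (_ * Y _ x).
transitivity (\sum_(j < k) (pairing (I x) (fun a f => riemann g a f (tnth E j) c x)
    (fun a f => Y [tuple of d :: [tuple of a :: tsubst E j f]] x)
  - 2 * kappa * Y [tuple of d :: [tuple of c :: E]] x)); last first.
  rewrite big_split /=; congr (_ + _).
  by rewrite sumr_const card_ord -mulr_natr; ring.
apply: eq_bigr => j _.
set y := fun a f => Y _ x.
transitivity (pairing (I x) (fun a f => riemann g a f (tnth E j) c x +
  kappa * (G x a (tnth E j) * G x f c - G x a c * G x f (tnth E j))) y).
  by apply: eq_pairing => // a f; exact: W.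
rewrite pairingDl pairingZl pairingBl !(pairing_metric (GC Ux) (IC Ux) (IG Ux)).
have -> : y (tnth E j) c = - y c (tnth E j) by exact: (skew_swap1 (skY Ux)).
by rewrite /y tsubst_id; congr (_ + _); ring.
Qed.

Lemma chart_killing_defect x c d (E : k.-tuple 'I_n) : U x ->
  l * (n%:R - k.+2%:R) * (nabla g h c [tuple of d :: E] x
                          + nabla g h d [tuple of c :: E] x) =
  2^-1 * (weyl_contr g Y c d E x + weyl_contr g Y d c E x).
Proof.
move=> Ux; have [kappa W] := weyl_einstein Ux.
have l0 : l != 0 by rewrite mulf_neq0 ?invr_eq0 ?pnatr_eq0.
have n0 : n%:R - k.+1%:R != 0 :> R.
  by rewrite -natrB ?pnatr_eq0 -?lt0n ?subn_gt0 ?(ltnW kn) // ltnW // ltnW.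
rewrite (@killing_defect _ _ _ (G x) (I x) (GC Ux) (IC Ux) (IG Ux)
  (fun a b d e => riemann_up g a b d e x) (fun a b c d => riemann g a b c d x)
  Lambda _ _ _ _ _ _ (Y ^~ x) (fun c B => nabla g h c B x)
  (fun c a B => nabla2 g Y c a B x) l (skY Ux)).
- rewrite !(weyl_contrE _ _ _ Ux W) (skew_swap01 (skY Ux) d c).
  by move: (Y _ _) => y; congr (_ * _); ring.
- by move=> a b c' e; exact: (riemann_up_raise gunit).
- by move=> a b c' e; exact: riemannC12.
- by move=> a b c' e; exact: (riemannC34 oU sg).
- by move=> a b c' e; exact: (riemann_pairC oU sg).
(* The identity at hand is cyclic in positions 1, 2, 4; skewness in the last pair makes it cyclic in
   1, 2, 3. *)
- move=> a b c' e; have := riemann_bianchi oU gC a b c' e Ux.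
  have C34 a' b' d' e' := riemannC34 oU sg gC gunit a' b' d' e' Ux.
  rewrite (C34 a b e c') (C34 b c' e a) (C34 c' a e b).
  move: (riemann _ _ _ _ _ _) (riemann _ _ _ _ _ _) (riemann _ _ _ _ _ _).
  by move=> r s t; lra.
- by move=> a b; exact: einstein.
- by move=> c' a; exact: (skew_nabla2 oU sg gunit).
- by move=> c' a b B; apply: (nabla2_CKY oU sg gC gunit) => // y; exact: CKY_sym_wedge.
- by move=> a b B; exact: (nabla2_ricci oU sg gC gunit).
- exact: l0.
- exact: n0.
Qed.

End ChartCKY.

(* p = k.+2 ranges over all orders with 2 < p < n. *)
Theorem mainTheorem4 (R : realType) (n k : nat) (M : manifold R n)
    (g : fields M 2) (Lambda : R) (Y : fields M k.+2) :
  (2 < k.+2 < n)%N ->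
  is_metric g -> is_einstein g Lambda ->
  is_CKY g Y -> ~ is_KY g Y ->
  is_KY g (CKY_h g Y) <-> weyl_condition g Y.
Proof.
move=> /andP[_ kn] [[sg _] gC gunit] ein [[sY _] skY [h [[sh th] skh cky]]] _.
have hE i x (B : k.+1.-tuple 'I_n) : cimg i x -> CKY_h g Y i B x = h i B x.
  exact: (CKY_h_eq (gC i) (gunit i) (skh i) kn (cky i) B).
have nhE i x a B : cimg i x ->
    nabla (g i) (CKY_h g Y i) a B x = nabla (g i) (h i) a B x.
  move=> Ux; apply: (nabla_eq_on _ (@cimg_open _ _ M i) _ _ Ux) => C y Uy; exact: hE.
have defect i x c d E (Ux : cimg i x) := chart_killing_defect (@cimg_open _ _ M i)
  (sg i) (gC i) (gunit i) (ein i) (sY i) (sh i) (skY i) (skh i) kn (cky i) c d E Ux.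
have wedge0 i x j a B :
    metric_wedge (k := j) (g i) (fun _ _ => 0) a B x = 0.
  by rewrite /metric_wedge /antisym big1 ?mulr0// => s _; rewrite !mulr0.
split=> [[_ _ ky] i x Ux c d E|wc].
  have := defect i x c d E Ux.
  have := ky i x Ux c d E; rewrite !wedge0 !nhE // !mulr0 addr0 => -> <-.
  by rewrite mulr0.
have nk : n%:R - k.+2%:R != 0 :> R.
  by rewrite -natrB ?(ltnW kn)// pnatr_eq0 -lt0n subn_gt0.
have l0 : 2 / k.+2%:R != 0 :> R by rewrite mulf_neq0 ?invr_eq0 ?pnatr_eq0.
split.
(* Smoothness and the transformation law of [CKY_h] are inherited from [h], with which it agrees on
   every chart image. *)
- split=> [i B|i j x Ux Vx B].
    by apply: smooth_on_eq (sh i B); [exact: cimg_open|move=> y Uy; rewrite hE].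
  rewrite hE // (th i j x Ux Vx); apply: eq_bigr => C _.
  by rewrite hE //; exact: coord_img.
- by move=> i x Ux B s; rewrite !hE // skh.
move=> i x Ux a b B; rewrite !wedge0 !nhE // !mulr0 addr0.
by apply: (mulfI (mulf_neq0 l0 nk)); rewrite mulr0 defect // wc.
Qed.
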